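(* Let $n\ge 1$ and consider the $(n,2,2)$ Bell scenario, with quantum correlation set $\mathcal Q\subseteq\mathbb R^{2^n\times 2^n}$. Let $p_{\tilde a}$ be a local deterministic correlation, and let $P\subseteq\mathbb R^{2^n\times 2^n}$ be a $2$-dimensional (affine) plane such that $p_{\tilde a}\in\mathcal Q\cap P$. Then there exists $r_P>0$ such that $$\mathrm{Ext}(\mathcal Q)\cap P\cap B(p_{\tilde a},r_P)=\{p_{\tilde a}\}.$$
   Context: In the $(n,2,2)$ scenario, correlations are real vectors $p=(p(a|x))_{a\in\mathbb Z_2^n,\,x\in\mathbb Z_2^n}\in\mathbb R^{2^n\times 2^n}$ ($x_i$ is the input and $a_i$ the output of party $i$). A local deterministic strategy is a family of functions $\tilde a=(\tilde a_i:\mathbb Z_2\to\mathbb Z_2)_{1\le i\le n}$; its local deterministic correlation is $p_{\tilde a}(a|x)=\prod_{i=1}^n\delta_{a_i,\tilde a_i(x_i)}$. A quantum strategy $((\mathcal H_i)_{1\le i\le n},\rho,(M^{(i)}_{x_i})_{1\le i\le n,\,x_i\in\mathbb Z_2})$ consists of Hilbert spaces $\mathcal H_i$, a density operator $\rho$ on $\mathcal H_1\otimes\cdots\otimes\mathcal H_n$, and for each $i$ and $x_i\in\mathbb Z_2$ a POVM $M^{(i)}_{x_i}=\{M^{(i)}_{0|x_i},M^{(i)}_{1|x_i}\}$ on $\mathcal H_i$. It realizes the correlation $p(a|x)=\mathrm{Tr}\big(\rho\,M^{(1)}_{a_1|x_1}\otimes\cdots\otimes M^{(n)}_{a_n|x_n}\big)$.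 $\mathcal Q$ is the (convex) set of all correlations realized by quantum strategies. $\mathrm{Ext}(C)$ denotes the set of extremal points of a convex set $C$, and $B(p,r)$ the Euclidean ball of center $p$ and radius $r$. *)

(* Defs.v *)
(* MathComp / MathComp-Analysis *)
From HB Require Import structures.
From mathcomp Require Import all_boot all_order all_algebra.
From mathcomp Require Import sesquilinear complex.
From mathcomp Require Import mathcomp_extra boolp classical_sets functions.
From mathcomp Require Import reals topology normedtype summability.

Set Implicit Arguments.
Unset Strict Implicit.
Unset Printing Implicit Defensive.

Import Order.TTheory GRing.Theory Num.Theory.
Import numFieldNormedType.Exports.

Local Open Scope classical_set_scope.
Local Open Scope ring_scope.
Local Open Scope complex_scope.

(* Complex Hilbert spaces, possibly infinite-dimensional and non-separable.
   Following the convention of sesquilinear.v, the inner product is linear in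
   its first argument and conjugate-linear in the second one. *)
HB.mixin Record isHilbert (R : realType) V & CompleteNormedModule R[i] V := {
  inner : {dot V for @Num.conj R[i]} ;
  inner_normE : forall x : V, inner x x = `|x| ^+ 2
}.

#[short(type="hilbertType")]
HB.structure Definition Hilbert (R : realType) :=
  {V of isHilbert R V & CompleteNormedModule R[i] V}.

Definition lin_span (K : numDomainType) (V : lmodType K) (A : set V) : set V :=
  [set v | exists (m : nat) (c : 'I_m -> K) (u : 'I_m -> V),
     (forall j, A (u j)) /\ v = \sum_(j < m) c j *: u j].

Section operators.
Context {R : realType} {H : hilbertType R}.
Implicit Types (A : H -> H).

Definition bounded_op (A : {linear H -> H}) : Prop := continuous A.

Definition positive_op A : Prop := forall v : H, 0 <= inner (A v) v.

Definition orthonormal_basis (I : choiceType) (e : I -> H) : Prop :=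
  (forall k l : I, inner (e k) (e l) = (k == l)%:R) /\
  closure (lin_span (range e)) = setT.

(* Tr A = c, the sum over the (possibly uncountable) index set of the basis
   being the limit of the net of finite partial sums. *)
Definition has_trace A (c : R[i]) : Prop :=
  forall (I : choiceType) (e : I -> H), orthonormal_basis e ->
    partial_sum (fun k => inner (A (e k)) (e k) : R[i]^o) @ totally
      --> (c : R[i]^o).

Definition density_op (rho : {linear H -> H}) : Prop :=
  [/\ bounded_op rho, positive_op rho & has_trace rho 1].

Definition povm (M : 'Z_2 -> {linear H -> H}) : Prop :=
  [/\ forall a, bounded_op (M a), forall a, positive_op (M a)
    & forall v : H, \sum_(a : 'Z_2) M a v = v].

End operators.

(* The Hilbert tensor product of the H i: a Hilbert space with an elementary
   tensor map x |-> x_1 (x) ... (x) x_n whose inner products factorize and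
   whose range is total. This determines it up to a unique unitary. *)
Record tensorProduct (R : realType) (n : nat) (H : 'I_n -> hilbertType R) :=
  TensorProduct {
    tensor_space :> hilbertType R ;
    tens : (forall i, H i) -> tensor_space ;
    tens_linear : forall (x : forall i, H i) (i : 'I_n) (c : R[i]) (u v : H i),
      tens (dfwith x i (c *: u + v)) =
      c *: tens (dfwith x i u) + tens (dfwith x i v) ;
    tens_inner : forall x y : forall i, H i,
      inner (tens x) (tens y) = \prod_(i < n) inner (x i) (y i) ;
    tens_total : closure (lin_span (range tens)) = setT
  }.

(* T = A_1 (x) ... (x) A_n; T is unique since elementary tensors are total. *)
Definition is_tensor_op (R : realType) (n : nat) (H : 'I_n -> hilbertType R)
    (K : tensorProduct H) (A : forall i, {linear H i -> H i})
    (T : {linear K -> K}) : Prop :=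
  bounded_op T /\
  forall x : forall i, H i, T (tens K x) = tens K (fun i => A i (x i)).

Record quantumStrategy (R : realType) (n : nat) := QuantumStrategy {
  qspace : 'I_n -> hilbertType R ;
  qtensor : tensorProduct qspace ;
  qstate : {linear qtensor -> qtensor} ;
  qstate_density : density_op qstate ;
  (* [qmeas i x a] is the effect of party i for input x and outcome a *)
  qmeas : forall i : 'I_n, 'Z_2 -> 'Z_2 -> {linear qspace i -> qspace i} ;
  qmeas_povm : forall i x, povm (qmeas i x)
}.

Definition bits (n : nat) := {ffun 'I_n -> 'Z_2}.

(* p(a|x) is [p (a, x)]. *)
Definition corr (R : realType) (n : nat) := {ffun bits n * bits n -> R^o}.

Definition realizes (R : realType) (n : nat) (S : quantumStrategy R n)
    (p : corr R n) : Prop :=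
  forall a x : bits n,
    exists T : {linear qtensor S -> qtensor S},
      is_tensor_op (fun i => qmeas S i (x i) (a i)) T /\
      has_trace (@qstate _ _ S \o T) (p (a, x))%:C.

Definition quantum_set (R : realType) (n : nat) : set (corr R n) :=
  [set p | exists S : quantumStrategy R n, realizes S p].
Arguments quantum_set : clear implicits.

Definition local_det (R : realType) (n : nat) (f : 'I_n -> 'Z_2 -> 'Z_2) :
    corr R n :=
  [ffun s : bits n * bits n => \prod_(i < n) (s.1 i == f i (s.2 i))%:R].
Arguments local_det R {n} f.

Definition Ext (R : realType) (E : lmodType R) (C : set E) : set E :=
  [set p | C p /\ forall (q r : E) (t : R), C q -> C r -> 0 < t < 1 ->
     p = t *: q + (1 - t) *: r -> q = p /\ r = p].

Definition euclidean_ball (R : realType) (n : nat) (p : corr R n) (r : R) :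
    set (corr R n) :=
  [set q | Num.sqrt (\sum_(s : bits n * bits n) (q s - p s) ^+ 2) < r].

Definition affine_plane (R : realType) (E : vectType R) (P : set E) : Prop :=
  exists (o : E) (V : {vspace E}),
    (\dim V = 2)%N /\ P = [set p | p - o \in V].

(* Main.v *)
(* After relabelling outputs, the local deterministic point p0 is the correlation
   in which every party always outputs 0.  Let eps(q) be the sum over x of
   1 - q(0|x).

   An extreme point q is realized by a pure state psi, and all effects act as
   projections on psi.  Let X, Y be the effects of a party j for its two inputs,
   and let L = X - Y, L' = 1 - X - Y.  Conjugation by L exchanges X with 1 - Y,
   conjugation by L' exchanges X with Y, and L^2 + L'^2 = 1: this splits q into
   two quantum correlations, hence <L^2 N psi, psi> = |L psi|^2 <N psi, psi> for
   every product N of effects of the other parties.  Since |L psi|^2 <= 4 eps(q),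
   Cauchy-Schwarz shows that changing the input of j changes q(a|x) by at most
   2 eps(q)^(3/2) whenever some party other than j outputs a nonzero bit in a.

   If these changes all vanish for a direction d with d(a|x) >= 0 for a <> 0, then
   p0 + d is, for small d, a mixture of local deterministic points.  In a plane
   through p0, the extreme points close to p0 therefore accumulate along one ray
   of such directions up to an error eps^(3/2), and of two of them on the same
   side of the ray the one much closer to p0 is a mixture of the other one and of
   a point of the ray. *)
Require Import Defs.
From HB Require Import structures.
From mathcomp Require Import all_boot all_order all_algebra.
From mathcomp Require Import sesquilinear complex finmap.
From mathcomp Require Import mathcomp_extra boolp classical_sets functions.
From mathcomp Require Import reals topology normedtype summability.
From mathcomp Require Import ring lra.
Set Implicit Arguments.
Unset Strict Implicit.
Unset Printing Implicit Defensive.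
Import Order.TTheory GRing.Theory Num.Theory.
Import numFieldNormedType.Exports.
Local Open Scope classical_set_scope.
Local Open Scope complex_scope.
Local Open Scope ring_scope.

(** * Hilbert spaces and positive operators *)

(** The Hilbert spaces are arbitrary, so the proof stays away from spectral theory. Positivity
    enters through Cauchy-Schwarz for the forms <A u, v>, through rank-one pieces peeled off a
    positive operator, and through the density of finite sums of elementary tensors. Extremality is
    used by altering the state and the measurements of a single party: q becomes a mixture of two
    quantum correlations, and both must equal q. The exponent 3/2 is the point of the estimate: |L
    psi| is of order eps^(1/2), and it multiplies a marginal probability of order eps. Since 3/2 >
    1, a limit direction of extreme points satisfies the flip equations exactly. In a plane this
    leaves one ray and one transversal coordinate b with b^2 = O(eps^3). Next to a fixed extreme
    point, a much closer one has b so small relative to its own eps that it falls into the triangle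
    spanned by the ray and the fixed point. A ray has two sides, so three extreme points suffice for
    a contradiction. *)

(* [inner] hides large canonical-structure terms, which slow rewriting down. *)
Definition ip (R : realType) (H : hilbertType R) (u v : H) : R[i] := inner u v.

Section hilbert_basics.
Context {R : realType} {H : hilbertType R}.
Implicit Types (u v w : H) (c : R[i]).

Lemma innerDl u v w : ip (u + v) w = ip u w + ip v w.
Proof. exact: linearDl. Qed.
Lemma innerNl u w : ip (- u) w = - ip u w.
Proof. exact: linearNl. Qed.
Lemma innerBl u v w : ip (u - v) w = ip u w - ip v w.
Proof. exact: linearBl. Qed.
Lemma inner0l w : ip 0 w = 0.
Proof. exact: linear0l. Qed.
Lemma innerZl c u w : ip (c *: u) w = c * ip u w.
Proof. exact: linearZl_LR. Qed.
Lemma innerC u v : ip u v = (ip v u)^*.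
Proof. by have := hermC (@inner R H) u v; rewrite expr0 mul1r. Qed.
Lemma inner_suml (I : Type) (r : seq I) (P : pred I) (F : I -> H) w :
  ip (\sum_(i <- r | P i) F i) w = \sum_(i <- r | P i) ip (F i) w.
Proof. exact: linear_sumlz. Qed.
Lemma innerDr u v w : ip u (v + w) = ip u v + ip u w.
Proof. exact: linearDr. Qed.
Lemma innerNr u w : ip u (- w) = - ip u w.
Proof. exact: linearNr. Qed.
Lemma innerBr u v w : ip u (v - w) = ip u v - ip u w.
Proof. exact: linearBr. Qed.
Lemma inner0r w : ip w 0 = 0.
Proof. exact: linear0r. Qed.
Lemma innerZr c u w : ip u (c *: w) = c^* * ip u w.
Proof. exact: linearZr_LR. Qed.
Lemma inner_sumr (I : Type) (r : seq I) (P : pred I) (F : I -> H) w :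
  ip w (\sum_(i <- r | P i) F i) = \sum_(i <- r | P i) ip w (F i).
Proof. exact: linear_sumr. Qed.

Lemma ip_normE u : ip u u = `|u| ^+ 2.
Proof. exact: inner_normE. Qed.
Lemma inner_ge0 u : 0 <= ip u u.
Proof. by rewrite ip_normE exprn_ge0. Qed.
Lemma inner_eq0 u : ip u u = 0 -> u = 0.
Proof. by rewrite ip_normE => /eqP; rewrite sqrf_eq0 normr_eq0 => /eqP. Qed.


Lemma sqr_norm_ge0 (z : R[i]) : 0 <= z * z^*.
Proof. exact: mul_conjC_ge0. Qed.

Lemma sqr_normE (z : R[i]) : z * z^* = `|z| ^+ 2.
Proof. by rewrite normCK. Qed.

Lemma positiveP (A : H -> H) v : positive_op A -> 0 <= ip (A v) v.
Proof. exact. Qed.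

Lemma positiveI (A : H -> H) : (forall v, 0 <= ip (A v) v) -> positive_op A.
Proof. exact. Qed.

Section positive.
Variable A : {linear H -> H}.
Hypothesis A_pos : positive_op A.

(** Polarisation over the complex numbers: the form is real at [u + v] and at [u + i v], which
    settles the imaginary and the real part of the identity. *)
Lemma positive_herm u v : ip (A u) v = ip u (A v).
Proof.
rewrite [RHS]innerC.
have h1 := ger0_Im (positiveP (u + v) A_pos).
have h2 := ger0_Im (positiveP (u + 'i%C *: v) A_pos).
have hu := ger0_Im (positiveP u A_pos).
have hv := ger0_Im (positiveP v A_pos).
move: h1 h2; rewrite !(linearD, linearZ)/= !(innerDl, innerDr, innerZl, innerZr).
case: (ip (A u) v) => a b; case: (ip (A v) u) => c d.
case: (ip (A u) u) hu => e f /= ->; case: (ip (A v) v) hv => k l /= ->.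
rewrite /= => h1 h2; apply/eqP; rewrite eq_complex/=; apply/andP.
by split; apply/eqP; lra.
Qed.

(** The form may be degenerate, hence the two cases on <A v, v>; each uses positivity at a single
    combination of [u] and [v]. *)
Lemma positive_CS u v :
  `|ip (A u) v| ^+ 2 <= ip (A u) u * ip (A v) v.
Proof.
set a := ip (A u) v; set p := ip (A u) u; set q := ip (A v) v.
have p0 : 0 <= p := positiveP u A_pos.
have q0 : 0 <= q := positiveP v A_pos.
have vu : ip (A v) u = a^* by rewrite positive_herm innerC.
have expand (s t : R[i]) : s^* = s ->
    ip (A (s *: u - t *: v)) (s *: u - t *: v) =
    s ^+ 2 * p - s * (t^* * a + (t^* * a)^*) + (t * t^*) * q.
  move=> hs; have -> : A (s *: u - t *: v) = s *: A u - t *: A v.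
    by rewrite linearB !linearZ.
  rewrite !(innerBl, innerBr, innerZl, innerZr) vu.
  rewrite -/a -/p -/q hs rmorphM /= conjCK. ring.
have real_conj (z : R[i]) : 0 <= z -> z^* = z.
  by move=> z0; apply: (CrealP (ger0_real z0)).
rewrite -sqr_normE; have aa0 := sqr_norm_ge0 a.
have [q00|qn0] := eqVneq q 0; last first.
  have qp : 0 < q by rewrite lt_def qn0.
  have := positiveP (q *: u - a *: v) A_pos; rewrite expand; last exact: real_conj.
  have -> : (a^* * a)^* = a^* * a.
    by apply: real_conj; rewrite mulrC.
  have -> : q ^+ 2 * p - q * (a^* * a + a^* * a) + a * a^* * q = q * (p * q - a * a^*).
    ring.
  by rewrite pmulr_rge0// subr_ge0.
(* For q = 0 the form at this combination equals -|a|^4 (p + 2), so a = 0. The 1 in p + 1 keeps the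
   last factor nonzero when p = 0. *)
have := positiveP ((a * a^*) *: u - ((p + 1) * a) *: v) A_pos.
rewrite expand; last exact: real_conj.
rewrite q00 !mulr0 addr0 => h.
have E : ((p + 1) * a)^* * a = (p + 1) * (a * a^*).
  rewrite rmorphM rmorphD/= rmorph1.
  rewrite (CrealP (ger0_real p0)). ring.
move: h; rewrite E (real_conj ((p + 1) * _)); last by rewrite mulr_ge0// addr_ge0.
have -> : (a * a^*) ^+ 2 * p - a * a^* * ((p + 1) * (a * a^*) + (p + 1) * (a * a^*))
  = - ((a * a^*) ^+ 2 * (p + 2)) by ring.
rewrite oppr_ge0 => h; rewrite -(@ler_pXn2r _ 2)// ?nnegrE// expr0n/=.
by rewrite -(pmulr_lle0 _ (_ : 0 < p + 2))// ltr_wpDl.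
Qed.

Lemma positive_ker v : ip (A v) v = 0 -> A v = 0.
Proof.
move=> h; apply: inner_eq0; apply/eqP.
have := positive_CS v (A v); rewrite h mul0r.
rewrite -sqrf_eq0 -normr_eq0 normrX => h'.
by rewrite eq_le h' exprn_ge0.
Qed.
End positive.

Lemma idfun_positive : positive_op (idfun : {linear H -> H}).
Proof. by move=> v; exact: inner_ge0. Qed.

Lemma inner_CS2 u v : `|ip u v| ^+ 2 <= ip u u * ip v v.
Proof. exact: (positive_CS idfun_positive). Qed.

Lemma inner_CS u v : `|ip u v| <= `|u| * `|v|.
Proof.
rewrite -(@ler_pXn2r _ 2)// ?nnegrE ?mulr_ge0// exprMn -!ip_normE.
exact: inner_CS2.
Qed.

Lemma closure_approx (D : set H) v (e : R[i]) : closure D = setT -> 0 < e ->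
  exists2 d, D d & `|v - d| < e.
Proof.
move=> cD e0; have : closure D v by rewrite cD.
move=> /(_ (ball v e)) [|d [Dd]]; first exact: nbhsx_ballx.
by rewrite -ball_normE /= => h; exists d.
Qed.

Lemma bounded_le (T : {linear H -> H}) : bounded_op T ->
  exists2 k, 0 < k & forall v, `|T v| <= k * `|v|.
Proof.
move=> /(_ 0) /continuous_linear_bounded /linear_boundedP /pinfty_ex_gt0[k k0 h].
by exists k.
Qed.

Lemma le_bounded (T : {linear H -> H}) k : 0 <= k ->
  (forall v, `|T v| <= k * `|v|) -> bounded_op T.
Proof.
move=> k0 h; apply: bounded_linear_continuous; apply/linear_boundedP.
near=> r => x; apply: le_trans (h x) _; apply: ler_wpM2r => //.
by near: r; apply: nbhs_pinfty_ge; rewrite ger0_real.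
Unshelve. all: by end_near. Qed.

End hilbert_basics.

(** * Orthonormal families and traces *)

Section orthonormal.
Context {R : realType} {H : hilbertType R}.
Implicit Types (u v w : H).

Definition orthonormal_family (I : choiceType) (e : I -> H) :=
  forall k l : I, ip (e k) (e l) = (k == l)%:R.

Definition oproj (I : choiceType) (e : I -> H) (G : seq I) u : H :=
  \sum_(k <- G) ip u (e k) *: e k.

Section family.
Context {I : choiceType} (e : I -> H) (oe : orthonormal_family e).

Lemma oproj_ortho (G : {fset I}) u k : k \in G ->
  ip (u - oproj e G u) (e k) = 0.
Proof.
move=> kG; rewrite innerBl inner_suml (big_rem k)//= innerZl oe eqxx mulr1.
rewrite big_seq big1 ?addr0 ?subrr// => l lG; rewrite innerZl oe.
case: eqVneq lG => [->|_]; last by rewrite mulr0.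
by rewrite (rem_filter _ (fset_uniq G)) mem_filter /= eqxx.
Qed.

Lemma oproj_inner (G : {fset I}) u v :
  ip u v - \sum_(k <- G) ip u (e k) * ip (e k) v =
  ip (u - oproj e G u) v.
Proof.
by rewrite innerBl inner_suml; congr (_ - _); apply: eq_bigr => k _; rewrite innerZl.
Qed.

(** The hypothesis puts [w] in the double orthogonal complement, hence in the span, of the [e k]
    with [k] in [G], without naming coefficients. *)
Lemma oproj_ortho_span (G : {fset I}) u w :
  (forall z, (forall k, k \in G -> ip z (e k) = 0) -> ip z w = 0) ->
  ip (u - oproj e G u) w = 0.
Proof. by apply=> k; exact: oproj_ortho. Qed.

Lemma oproj_self_ortho (G : {fset I}) u :
  ip (u - oproj e G u) (oproj e G u) = 0.
Proof.
apply: oproj_ortho_span => z hz; rewrite inner_sumr big_seq big1// => k kG.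
by rewrite innerZr hz// mulr0.
Qed.

Lemma bessel_eq (G : {fset I}) u :
  ip u u = \sum_(k <- G) `|ip u (e k)| ^+ 2
    + ip (u - oproj e G u) (u - oproj e G u).
Proof.
rewrite [in X in _ + X]innerBr oproj_self_ortho subr0 -oproj_inner.
rewrite [X in _ - X](_ : _ = \sum_(k <- G) `|ip u (e k)| ^+ 2).
  by rewrite addrC subrK.
by apply: eq_bigr => k _; rewrite normCK -innerC.
Qed.

Lemma oproj_best (G : {fset I}) u w :
  (forall z, (forall k, k \in G -> ip z (e k) = 0) -> ip z w = 0) ->
  `|u - oproj e G u| <= `|u - w|.
Proof.
move=> hw; have o1 := oproj_ortho_span u hw; have o2 := oproj_self_ortho G u.
rewrite -(@ler_pXn2r _ 2)// ?nnegrE// -!ip_normE.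
set z := u - oproj e G u in o1 o2 *.
have -> : u - w = z + (oproj e G u - w) by rewrite /z addrA subrK.
have o3 : ip z (oproj e G u - w) = 0 by rewrite innerBr o1 o2 subrr.
clearbody z; move: (oproj e G u - w) o3 => y o3.
rewrite [leRHS]innerDl !innerDr o3 (innerC y z) o3 conjC0 addr0 add0r lerDl.
exact: inner_ge0.
Qed.
End family.

Lemma oproj_approx (I : choiceType) (e : I -> H) u (eps : R[i]) :
  orthonormal_basis e -> 0 < eps ->
  exists G0 : {fset I}, forall G : {fset I}, (G0 `<=` G)%fset ->
    `|u - oproj e G u| < eps.
Proof.
move=> [oe ce] e0; have [w [m [c [x [hx ->]]]] hw] := closure_approx u ce e0.
have /choice[i hi] : forall j, exists k, e k = x j.
  by move=> j; have [k _ <-] := hx j; exists k.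
exists [fset i j | j in 'I_m]%fset => G GG; apply: le_lt_trans hw.
apply: oproj_best => // z hz; rewrite inner_sumr big1// => j _.
rewrite innerZr -hi hz ?mulr0//; apply: (fsubsetP GG).
by apply/imfsetP; exists j.
Qed.

Lemma parseval (I : choiceType) (e : I -> H) u v (eps : R[i]) :
  orthonormal_basis e -> 0 < eps ->
  exists G0 : {fset I}, forall G : {fset I}, (G0 `<=` G)%fset ->
    `|ip u v - \sum_(k <- G) ip u (e k) * ip (e k) v| < eps.
Proof.
move=> be e0; have v0 : 0 < `|v| + 1 by rewrite ltr_wpDl.
have [G0 hG] := oproj_approx u be (divr_gt0 e0 v0).
exists G0 => G GG; rewrite oproj_inner; apply: le_lt_trans (inner_CS _ _) _.
have := hG _ GG; rewrite ltr_pdivlMr// => h; apply: le_lt_trans h.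
by rewrite ler_wpM2l// lerDl.
Qed.

Lemma partial_sumE (I : choiceType) (V : zmodType) (x : I -> V) (A : {fset I}) :
  partial_sum x A = \sum_(k <- A) x k.
Proof. by rewrite (big_seq_fsetE _ _ predT). Qed.

#[local] Existing Instance totally_filter.

Lemma has_traceP (A : H -> H) c :
  has_trace A c <->
  forall (I : choiceType) (e : I -> H), orthonormal_basis e ->
    forall eps : R[i], 0 < eps ->
    exists G0 : {fset I}, forall G : {fset I}, (G0 `<=` G)%fset ->
    `|c - \sum_(k <- G) ip (A (e k)) (e k)| < eps.
Proof.
split=> [h I e be eps e0|h I e be].
  have /cvgrPdist_lt/(_ _ e0) := h I e be.
  case=> G0 _ hG; exists G0 => G GG; have := hG G GG.
  by rewrite /= partial_sumE.
apply/cvgrPdist_lt => eps e0; have [G0 hG] := h I e be eps e0.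
by exists G0 => // G GG; rewrite /= partial_sumE; exact: hG.
Qed.

Lemma has_traceD (A B : H -> H) a b :
  has_trace A a -> has_trace B b -> has_trace (fun v => A v + B v) (a + b).
Proof.
move=> /has_traceP hA /has_traceP hB; apply/has_traceP => I e be eps e0.
have e2 : 0 < eps / 2 by rewrite divr_gt0.
have [G0 h0] := hA I e be _ e2; have [G1 h1] := hB I e be _ e2.
exists (G0 `|` G1)%fset => G; rewrite fsubUset => /andP[g0 g1].
under eq_bigr do rewrite innerDl.
rewrite big_split/= opprD addrACA (splitr eps).
by apply: le_lt_trans (ler_normD _ _) _; rewrite ltrD ?h0 ?h1.
Qed.

Lemma has_traceZ (A : H -> H) a c :
  has_trace A a -> has_trace (fun v => c *: A v) (c * a).
Proof.
move=> /has_traceP hA; apply/has_traceP => I e be eps e0.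
have c0 : 0 < `|c| + 1 by rewrite ltr_wpDl.
have [G0 h0] := hA I e be _ (divr_gt0 e0 c0); exists G0 => G GG.
under eq_bigr do rewrite innerZl.
rewrite -mulr_sumr -mulrBr normrM; have := h0 _ GG; rewrite ltr_pdivlMr// => h.
by apply: le_lt_trans h; rewrite mulrC ler_wpM2l// lerDl.
Qed.

(** The operator |psi><psi|; [psi] is not normalised, so that it also carries the weight of a pure
    component. *)
Definition rank1 (psi : H) : H -> H := fun v => ip v psi *: psi.
Lemma rank1_is_linear psi : linear (rank1 psi).
Proof. by move=> c u v; rewrite /rank1 innerDl innerZl scalerDl scalerA. Qed.
HB.instance Definition _ psi :=
  GRing.isLinear.Build _ _ _ _ (rank1 psi) (rank1_is_linear psi).

Lemma rank1_positive psi : positive_op (rank1 psi).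
Proof. by apply: positiveI => v; rewrite /rank1 innerZl (innerC psi) mul_conjC_ge0. Qed.

Lemma rank1_bounded psi : bounded_op (rank1 psi).
Proof.
apply: (@le_bounded _ _ _ (`|psi| ^+ 2)); first by rewrite exprn_ge0.
move=> v; rewrite normrZ expr2 mulrC -mulrA ler_wpM2l// mulrC.
exact: inner_CS.
Qed.

Lemma rank1_trace psi (T : {linear H -> H}) : positive_op T ->
  has_trace (rank1 psi \o T) (ip (T psi) psi).
Proof.
move=> pT; apply/has_traceP => I e be eps e0.
have [G0 hG] := parseval psi (T psi) be e0; exists G0 => G /hG.
rewrite (positive_herm pT); congr (`|_ - _| < _); apply: eq_bigr => k _ /=.
by rewrite /rank1 innerZl (positive_herm pT) mulrC.
Qed.

End orthonormal.

Section complex_order.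
Context {R : realType}.
Implicit Types z : R[i].

Lemma Re_le_norm z : `|complex.Re z|%:C <= `|z|.
Proof.
rewrite normc_def lecR -sqrtr_sqr ler_sqrt; last by rewrite addr_ge0// sqr_ge0.
by rewrite lerDl sqr_ge0.
Qed.

Lemma Im_le_norm z : `|complex.Im z|%:C <= `|z|.
Proof.
rewrite normc_def lecR -sqrtr_sqr ler_sqrt; last by rewrite addr_ge0// sqr_ge0.
by rewrite lerDr sqr_ge0.
Qed.

(** In [R[i]], [0 <= z] includes that z is real. A nonzero imaginary part and a negative real part
    are excluded separately, each with its own size as tolerance. *)
Lemma ge0_approx z :
  (forall e : R[i], 0 < e -> exists2 y, 0 <= y & `|z - y| < e) -> 0 <= z.
Proof.
move=> h; rewrite lecE /=; apply/andP; split; apply: contraT.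
  move=> z0; have : 0 < `|complex.Im z|%:C by rewrite ltcR normr_gt0.
  move=> /h[y y0]; move/(le_lt_trans (Im_le_norm _)); rewrite ltcR.
  have -> : complex.Im (z - y) = complex.Im z.
    by have := ger0_Im y0; case: (z) (y) => [? ?] [? ?] /= ->; rewrite subr0.
  by rewrite ltxx.
rewrite -ltNge => z0; have : 0 < `|complex.Re z|%:C.
  by rewrite ltcR normr_gt0 lt_eqF.
move=> /h[y y0]; move/(le_lt_trans (Re_le_norm _)); rewrite ltcR.
have : 0 <= complex.Re y by move: y0; rewrite lecE => /andP[].
case: (z) (y) z0 => [a b] [c d] /= a0 c0.
rewrite !ltr0_norm//; lra.
Qed.

Lemma eq_approx z y : (forall e : R[i], 0 < e -> `|z - y| < e) -> z = y.
Proof.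
move=> h; apply/eqP; rewrite -subr_eq0; apply: contraT => n0.
by have := h `|z - y|; rewrite normr_gt0 n0 ltxx => /(_ isT).
Qed.
End complex_order.

Section span.
Context {K : numDomainType} {V : lmodType K}.
Implicit Types (A : set V).

Lemma lin_span_sub A a : A a -> lin_span A a.
Proof.
by move=> Aa; exists 1%N, (fun=> 1), (fun=> a); rewrite big_ord1 scale1r.
Qed.

Lemma lin_span0 A : lin_span A 0.
Proof. by exists 0%N, (fun=> 0), (fun=> 0); rewrite big_ord0; split=> // -[]. Qed.

Lemma lin_spanZ A c v : lin_span A v -> lin_span A (c *: v).
Proof.
move=> [m [d [u [hu ->]]]]; exists m, (fun j => c * d j), u; split=> //.
by rewrite scaler_sumr; apply: eq_bigr => j _; rewrite scalerA.
Qed.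

Lemma lin_spanD A v w : lin_span A v -> lin_span A w -> lin_span A (v + w).
Proof.
move=> [m [d [u [hu ->]]]] [m' [d' [u' [hu' ->]]]].
exists (m + m')%N,
  (fun j : 'I_(m + m') =>
    match fintype.split j with inl i => d i | inr i => d' i end),
  (fun j : 'I_(m + m') =>
    match fintype.split j with inl i => u i | inr i => u' i end).
split; first by move=> j; case: fintype.split.
rewrite big_split_ord/=; congr (_ + _); apply: eq_bigr => j _.
  by rewrite (unsplitK (inl j)).
by rewrite (unsplitK (inr j)).
Qed.
End span.

(** * Orthogonal projection and existence of orthonormal bases *)

Section projection.
Context {R : realType} {H : hilbertType R}.
Implicit Types (u v w : H).

Definition sqn v : R := complex.Re (ip v v).
Lemma sqnE v : (sqn v)%:C = ip v v.
Proof. by rewrite /sqn RRe_real// ger0_real// inner_ge0. Qed.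
Lemma sqn_ge0 v : 0 <= sqn v.
Proof. by rewrite -lecR sqnE inner_ge0. Qed.
Lemma norm_lt_sqn v (e : R) : 0 < e -> (`|v| < e%:C) = (sqn v < e ^+ 2).
Proof.
move=> e0; rewrite -ltcR sqnE ip_normE rmorphXn/= ltr_pXn2r ?nnegrE//.
by rewrite lecR ltW.
Qed.

Lemma parallelogram u v : sqn (u - v) = 2 * sqn u + 2 * sqn v - 4 * sqn (2^-1 *: (u + v)).
Proof.
apply: complexI; rewrite rmorphB rmorphD !rmorphM/= !sqnE.
rewrite innerZl innerZr fmorphV/= conjC_nat !(innerDl,innerDr,innerNl,innerNr).
rewrite !rmorph_nat. by field.
Qed.

(** The projection theorem: by the parallelogram law a minimising sequence for the distance from [v]
    to the span is Cauchy; with l its limit, [v - l] is the vector sought, nonzero because [v] is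
    outside the closure. *)
Lemma orthogonal_vector (A : set H) v : (forall a, A a -> ip a a = 1) ->
  ~ closure (lin_span A) v -> exists2 w, w != 0 & forall a, A a -> ip w a = 0.
Proof.
move=> A1 nv; pose E := [set x : R | exists2 s, lin_span A s & x = sqn (v - s)].
have Einf : has_inf E.
  split; first by exists (sqn (v - 0)), 0 => //; exact: lin_span0.
  by exists 0 => x [s _ ->]; exact: sqn_ge0.
pose D := inf E.
have D_le s : lin_span A s -> D <= sqn (v - s).
  by move=> hs; apply: ge_inf; [case: Einf|exists s].
have /choice[s hs] : forall n : nat,
    exists s, lin_span A s /\ sqn (v - s) < D + n.+1%:R^-1.
  move=> n; have n0 : 0 < n.+1%:R^-1 :> R by rewrite invr_gt0.
  by have [x [s hs ->] hx] := inf_adherent n0 Einf; exists s.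
have inv_small (e : R) : 0 < e -> exists n : nat, forall m, (n <= m)%N -> m.+1%:R^-1 < e.
  move=> e0; exists (Num.truncn e^-1) => m nm.
  rewrite -[e]invrK ltf_pV2 ?posrE ?invr_gt0//.
  by apply: lt_le_trans (truncnS_gt _) _; rewrite ler_nat.
have s_cauchy : cauchy (s @ \oo).
  apply/cauchyP => e e0.
  have er : e = (complex.Re e)%:C by rewrite RRe_real// gtr0_real.
  have r0 : 0 < complex.Re e by rewrite -ltcR -er.
  (* Two points at squared distance below D + e^2/4 from v, whose midpoint is at squared distance at
     least D, are at squared distance below e^2 from each other. *)
  have [n hn] := inv_small _ (divr_gt0 (exprn_gt0 2 r0) (ltr0n R 4)).
  exists (s n); exists n => // m /= nm; rewrite -ball_normE/= er norm_lt_sqn//.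
  have -> : s n - s m = (v - s m) - (v - s n) by rewrite opprB [RHS]addrC addrA subrK.
  rewrite parallelogram.
  have -> : 2^-1 *: (v - s m + (v - s n)) = v - 2^-1 *: (s m + s n).
    rewrite addrACA -opprD scalerDr scalerN -mulr2n -[v *+ 2]scaler_nat scalerA.
    by rewrite mulVf ?pnatr_eq0// scale1r.
  have hmid : lin_span A (2^-1 *: (s m + s n)).
    by apply: lin_spanZ; apply: lin_spanD; [exact: (hs m).1|exact: (hs n).1].
  have := D_le _ hmid; have := (hs m).2; have := (hs n).2; have := hn n (leqnn n).
  have := hn m nm.
  move: (m.+1%:R^-1) (n.+1%:R^-1) (sqn _) (sqn _) (sqn _) => *; lra.
have /cauchy_cvgP/cvg_ex[/= l hl] := s_cauchy.
exists (v - l).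
  apply/eqP => /eqP; rewrite subr_eq0 => /eqP vl; apply: nv; rewrite vl => B Bl.
  have /= := hl _ Bl => -[n _ hn]; exists (s n); split; first exact: (hs n).1.
  by apply: hn => /=.
move=> a Aa; apply: eq_approx => e e0; rewrite subr0.
have er : e = (complex.Re e)%:C by rewrite RRe_real// gtr0_real.
have r0 : 0 < complex.Re e / 2 by rewrite divr_gt0// -ltcR -er.
have [n hn] := inv_small _ (exprn_gt0 2 r0).
have /cvgrPdist_lt := hl; move=> /(_ (complex.Re e / 2)%:C); rewrite ltcR => /(_ r0).
move=> [k _ hk]; pose m := maxn n k.
have -> : v - l = (v - s m) + (s m - l) by rewrite addrA subrK.
rewrite innerDl; apply: le_lt_trans (ler_normD _ _) _.
have -> : e = (complex.Re e / 2)%:C + (complex.Re e / 2)%:C.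
  by rewrite -rmorphD/= -splitr.
apply: ltrD; last first.
  apply: le_lt_trans (inner_CS _ _) _.
  have -> : `|a| = 1.
    apply/eqP; rewrite -(@pexpr_eq1 _ _ 2)//; apply/eqP.
    by rewrite -ip_normE A1.
  by rewrite mulr1 distrC; apply: hk; rewrite /m/= leq_maxr.
move xE : (v - s m) => x.
(* Moving [s m] by <x, a> a lowers the squared distance by |<x, a>|^2, but not below D; hence |<x,
   a>|^2 < 1/(m+1). *)
have : sqn (x - ip x a *: a) >= D.
  rewrite -{1}xE -addrA -opprD; apply: D_le; apply: lin_spanD; first exact: (hs m).1.
  by apply: lin_spanZ; exact: lin_span_sub.
have -> : sqn (x - ip x a *: a) = sqn x - complex.Re (`|ip x a| ^+ 2).
  apply: complexI; rewrite sqnE [RHS](_ : _ = ip x x - `|ip x a| ^+ 2); last first.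
    rewrite rmorphB; congr (_ - _); first exact: sqnE.
    by apply: RRe_real; rewrite ger0_real// exprn_ge0.
  rewrite innerBl !innerBr !innerZl !innerZr (A1 a Aa) (innerC a x) normCK. ring.
move=> hD; have := (hs m).2; rewrite xE => hx.
have nn : `|ip x a| \is Num.nneg by rewrite nnegrE.
have nr : (complex.Re e / 2)%:C \is Num.nneg by rewrite nnegrE lecR ltW.
rewrite -(@ltr_pXn2r _ 2 isT _ _ nn nr).
have -> : `|ip x a| ^+ 2 = (complex.Re (`|ip x a| ^+ 2))%:C.
  by rewrite RRe_real// ger0_real// exprn_ge0.
have -> : (complex.Re e / 2)%:C ^+ 2 = ((complex.Re e / 2) ^+ 2)%:C by rewrite rmorphXn.
rewrite ltcR; have := hn m (leq_maxl _ _); rewrite -/m.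
move: hx hD; move: (m.+1%:R^-1) => *; lra.
Qed.

(** [has_trace] quantifies over all bases and would be vacuous without one, so uniqueness and sign
    of a trace rest on this. A maximal orthonormal set is total, since otherwise [orthogonal_vector]
    would enlarge it. *)
Lemma exists_orthonormal_basis :
  exists (I : choiceType) (e : I -> H), orthonormal_basis e.
Proof.
pose P (A : set H) := forall u v, A u -> A v -> ip u v = (u == v)%:R.
have [|A [PA Amax]] := @Zorn_bigcup H P.
  move=> F FP Ftot u v [X FX Xu] [Y FY Yv].
  have [/(_ _ Xu) Yu|/(_ _ Yv) Xv] := Ftot _ _ FX FY.
    exact: FP FY _ _ Yu Yv.
  exact: FP FX _ _ Xu Xv.
have A1 a : A a -> ip a a = 1 by move=> Aa; rewrite PA// eqxx.
exists {x : H | x \in A}, (fun x => val x); split.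
  move=> [k Ak] [l Al]; rewrite -[LHS]/(ip k l) PA//; exact: set_mem.
have -> : range (fun x : {x : H | x \in A} => val x) = A.
  apply/seteqP; split=> [_ [[x xA] _ <-]|x Ax] /=; first exact: set_mem.
  by exists (exist _ x (mem_set Ax)).
apply/seteqP; split=> // v _; apply: contrapT => /(orthogonal_vector A1)[w w0 wA].
pose w1 := `|w|^-1 *: w.
have n0 : `|w| != 0 by rewrite normr_eq0.
have w1A a : A a -> ip w1 a = 0 by move=> Aa; rewrite innerZl wA// mulr0.
have w11 : ip w1 w1 = 1.
  rewrite innerZl innerZr ip_normE fmorphV/= (CrealP (ger0_real (normr_ge0 w))).
  by field.
apply: (Amax (A `|` [set w1])).
  split; first by left.
  move=> h; have := w1A w1 (h w1 (or_intror erefl)).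
  by rewrite w11 => /eqP; rewrite oner_eq0.
have neq a : A a -> (a == w1) = false.
  by move=> Aa; apply/eqP => e; have := w1A a Aa; rewrite e w11 => /eqP; rewrite oner_eq0.
move=> x y [Ax|->] [Ay|->]; first exact: PA.
- by rewrite innerC w1A// conjC0 neq.
- by rewrite w1A// eq_sym neq.
- by rewrite w11 eqxx.
Qed.
End projection.

(** * Traces and rank-one decompositions of positive operators *)

Section trace.
Context {R : realType} {H : hilbertType R}.
Implicit Types (u v w : H) (A B T : {linear H -> H}).

Lemma has_trace_unique (A : H -> H) a b : has_trace A a -> has_trace A b -> a = b.
Proof.
move=> /has_traceP hA /has_traceP hB; apply: eq_approx => eps e0.
have [I [e be]] := exists_orthonormal_basis (H := H).
have e2 : 0 < eps / 2 by rewrite divr_gt0.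
have [G0 h0] := hA I e be _ e2; have [G1 h1] := hB I e be _ e2.
have := h0 _ (fsubsetUl G0 G1); have := h1 _ (fsubsetUr G0 G1).
set S := \sum_(k <- _) _ => hb ha.
have -> : a - b = (a - S) + (S - b) by rewrite addrA subrK.
by rewrite (splitr eps); apply: le_lt_trans (ler_normD _ _) _; rewrite ltrD// distrC.
Qed.

Lemma eq_has_trace (A B : H -> H) a : A =1 B -> has_trace A a -> has_trace B a.
Proof. by move=> /funext ->. Qed.

Lemma has_trace0 : has_trace (fun _ : H => 0 : H) 0.
Proof.
apply/has_traceP => I e _ eps e0; exists fset0 => G _.
by rewrite big1 ?subrr ?normr0// => k _; rewrite inner0l.
Qed.

Lemma has_trace_sum (I : Type) (r : seq I) (A : I -> H -> H) (a : I -> R[i]) :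
  (forall i, has_trace (A i) (a i)) ->
  has_trace (fun v => \sum_(i <- r) A i v) (\sum_(i <- r) a i).
Proof.
move=> h; elim: r => [|i r IH].
  by rewrite big_nil; apply: eq_has_trace has_trace0 => v; rewrite big_nil.
rewrite big_cons; apply: eq_has_trace (has_traceD (h i) IH) => v.
by rewrite big_cons.
Qed.

Lemma has_traceB (A B : H -> H) a b :
  has_trace A a -> has_trace B b -> has_trace (fun v => A v - B v) (a - b).
Proof.
move=> hA /(has_traceZ (c := -1)) hB; rewrite -mulN1r.
by apply: eq_has_trace (has_traceD hA hB) => v; rewrite scaleN1r.
Qed.

Lemma has_trace_ge0 (A : H -> H) a : positive_op A -> has_trace A a -> 0 <= a.
Proof.
move=> pA /has_traceP hA; have [I [e be]] := exists_orthonormal_basis (H := H).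
apply: ge0_approx => eps e0; have [G hG] := hA I e be _ e0.
exists (\sum_(k <- G) ip (A (e k)) (e k)); last exact: hG.
by rewrite sumr_ge0// => k _; exact: positiveP.
Qed.

Lemma rank1_has_trace (psi : H) : has_trace (rank1 psi) (ip psi psi).
Proof. exact: (rank1_trace (psi := psi) idfun_positive). Qed.

(* Schur complement: removing |Au><Au| / <Au, u> from a positive operator A
   leaves a positive operator, by Cauchy-Schwarz. *)
Lemma rank1_peel A u : positive_op A -> ip (A u) u != 0 ->
  exists2 p, forall v, rank1 p v = (ip (A v) u / ip (A u) u) *: A u
    & forall v, 0 <= ip (A v - rank1 p v) v.
Proof.
move=> pA q0; set q := ip (A u) u in q0 *.
have qge0 : 0 <= q := positiveP u pA.
have qgt0 : 0 < q by rewrite lt_def q0.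
have rE v : rank1 ((sqrtC q)^-1 *: A u) v = (ip (A v) u / q) *: A u.
  rewrite /rank1 innerZr scalerA -(positive_herm pA) fmorphV/=; congr (_ *: _).
  rewrite (CrealP (ger0_real _)) ?sqrtC_ge0// -[in RHS](sqrtCK q).
  by field; rewrite sqrtC_eq0.
exists ((sqrtC q)^-1 *: A u) => [//|v].
rewrite rE innerBl innerZl subr_ge0 (innerC (A u)) -(positive_herm pA).
rewrite mulrAC -normCK ler_pdivrMr//; exact: positive_CS.
Qed.

(** Peeling along a vector puts it into the kernel of the remainder. Vectors already in the kernel
    stay there, because the peeled piece at v is a multiple of <B v, u>. *)
Lemma cholesky A (s : seq H) : positive_op A ->
  exists (ps : seq H) B, [/\ positive_op B,
    forall v, A v = \sum_(p <- ps) rank1 p v + B v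
    & forall u, u \in s -> B u = 0].
Proof.
move=> pA; elim: s => [|u s [ps [B [pB AE Bs]]]].
  by exists [::], A; split=> // v; rewrite big_nil add0r.
have [Bu|Bu] := eqVneq (ip (B u) u) 0.
  exists ps, B; split=> // v; rewrite inE => /orP[/eqP ->|]; last exact: Bs.
  by apply: (positive_ker pB).
have [p pE pp] := rank1_peel pB Bu.
exists (p :: ps), (B \- rank1 p); split=> [|v|v] /=.
- by apply: positiveI => v; exact: pp.
- by rewrite big_cons AE -addrA addrCA; congr (_ + _); rewrite [RHS]addrC subrK.
- rewrite inE => /orP[/eqP ->|vs]; first by rewrite pE divff// scale1r subrr.
  by rewrite pE Bs// inner0l mul0r scale0r subrr.
Qed.

(** Cauchy-Schwarz for T between v and T v: |T v|^4 <= <T v, v> <T T v, T v> <= |v|^2 |T v|^2. *)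
Lemma contraction_norm T v : positive_op T ->
  (forall v, ip (T v) v <= ip v v) -> `|T v| <= `|v|.
Proof.
move=> pT cT; have [->|Tv0] := eqVneq (T v) 0; first by rewrite normr0.
have : `|ip (T v) (T v)| ^+ 2 <= ip v v * ip (T v) (T v).
  apply: le_trans (positive_CS pT v (T v)) _.
  by apply: ler_pM => //; apply: positiveP.
rewrite !ip_normE (ger0_norm (exprn_ge0 2 (normr_ge0 (T v)))) [X in X <= _]expr2.
have n0 : 0 < `|T v| ^+ 2 by rewrite exprn_gt0// normr_gt0.
by rewrite ler_pM2r// ler_pXn2r// nnegrE.
Qed.

(* On the span of a finite part G of a basis, rho is a sum of rank-one operators
   |p><p|, and the partial trace of rho T over G is close to the sum of the
   <T p, p>; no square root of rho or T is needed. *)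
Lemma trace_mul_ge0 (rho T : {linear H -> H}) t c :
  positive_op rho -> has_trace rho t ->
  positive_op T -> (forall v, ip (T v) v <= ip v v) ->
  has_trace (rho \o T) c -> 0 <= c.
Proof.
move=> pr /[dup] tr /has_traceP htr pT cT /has_traceP hc.
have [I [e be]] := exists_orthonormal_basis (H := H).
have oe : orthonormal_family e := be.1.
have t0 : 0 <= t := has_trace_ge0 pr tr.
apply: ge0_approx => eps e0.
(* The error eps is spent as eta on truncating the trace and (1 + t) eta on the sum of |d p| |p| <=
   |d p|^2 / eta + eta |p|^2, whose two parts add up to at most eta and eta t. *)
pose eta := eps / (2 + t).
have d0 : 0 < 2 + t by rewrite ltr_wpDr.
have eta0 : 0 < eta by rewrite divr_gt0.
have eta20 : 0 < eta ^+ 2 by rewrite exprn_gt0.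
have [G0 h0] := hc I e be _ eta0; have [G1 h1] := htr I e be _ eta20.
pose G := (G0 `|` G1)%fset.
have {}h0 := h0 G (fsubsetUl _ _); have {}h1 := h1 G (fsubsetUr _ _).
have [ps [B [pB rE Bk]]] := cholesky [seq e k | k <- G] pr.
have {}Bk k : k \in G -> B (e k) = 0 by move=> kG; apply: Bk; exact: map_f.
have ps_le : \sum_(p <- ps) ip p p <= t.
  rewrite -subr_ge0; apply: (has_trace_ge0 pB).
  have hs := @has_trace_sum _ ps (fun p => rank1 p) (fun p => ip p p)
    (fun p => @rank1_has_trace p).
  apply: eq_has_trace (has_traceB tr hs) => v /=.
  by rewrite rE addrC addKr.
pose d p := p - oproj e G p.
have rG : \sum_(k <- G) ip (rho (e k)) (e k) =
    \sum_(p <- ps) \sum_(k <- G) `|ip p (e k)| ^+ 2.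
  rewrite exchange_big/= big_seq [RHS]big_seq; apply: eq_bigr => k kG.
  rewrite rE Bk// addr0 inner_suml; apply: eq_bigr => p _.
  by rewrite /rank1 innerZl (innerC _ p) mulrC normCK.
have d_le : \sum_(p <- ps) ip (d p) (d p) <= eta ^+ 2.
  have -> : \sum_(p <- ps) ip (d p) (d p) =
      \sum_(p <- ps) ip p p - \sum_(k <- G) ip (rho (e k)) (e k).
    rewrite rG -sumrB; apply: eq_bigr => p _.
    by rewrite [in RHS](bessel_eq oe G p) addrC addKr.
  apply: le_trans (ltW h1).
  apply: le_trans (_ : _ <= t - \sum_(k <- G) ip (rho (e k)) (e k)) _.
    by rewrite lerD2r.
  by apply: real_ler_norm; rewrite realB ?ger0_real// sumr_ge0// => k _; exact: positiveP.
have TG : \sum_(k <- G) ip (rho (T (e k))) (e k) =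
    \sum_(p <- ps) ip (T p) p - \sum_(p <- ps) ip (T (d p)) p.
  rewrite -sumrB.
  transitivity (\sum_(p <- ps) \sum_(k <- G) ip p (e k) * ip (T (e k)) p).
    rewrite exchange_big/= big_seq [RHS]big_seq; apply: eq_bigr => k kG.
    rewrite (positive_herm pr) rE Bk// addr0 inner_sumr; apply: eq_bigr => p _.
    by rewrite /rank1 innerZr -innerC.
  apply: eq_bigr => p _; rewrite -innerBl -linearB /d opprB addrC subrK.
  rewrite /oproj linear_sum inner_suml; apply: eq_bigr => k _.
  by rewrite linearZ innerZl.
exists (\sum_(p <- ps) ip (T p) p).
  by rewrite sumr_ge0// => p _; exact: positiveP.
have -> : c - \sum_(p <- ps) ip (T p) p =
  (c - \sum_(k <- G) ip (rho (T (e k))) (e k)) - \sum_(p <- ps) ip (T (d p)) p.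
  by rewrite TG; ring.
apply: le_lt_trans (ler_normB _ _) _.
have -> : eps = eta + (1 + t) * eta.
  by rewrite /eta; field; rewrite gt_eqF.
apply: ltr_leD => //; apply: le_trans (ler_norm_sum _ _ _) _.
apply: (@le_trans _ _ (\sum_(p <- ps) (ip (d p) (d p) / eta + eta * ip p p))).
  apply: ler_sum => p _; apply: le_trans (inner_CS _ _) _.
  apply: le_trans (ler_wpM2r _ (contraction_norm _ pT cT)) _ => //.
  rewrite !ip_normE -subr_ge0.
  have -> : `|d p| ^+ 2 / eta + eta * `|p| ^+ 2 - `|d p| * `|p| =
    ((`|d p| - eta * `|p|) ^+ 2 + `|d p| * `|p| * eta) / eta.
    by field; rewrite gt_eqF.
  have sq : 0 <= (`|d p| - eta * `|p|) ^+ 2.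
    rewrite real_exprn_even_ge0// realB ?ger0_real// mulr_ge0//; exact: ltW.
  rewrite divr_ge0 ?(ltW eta0)// addr_ge0// mulr_ge0 ?(ltW eta0)//.
  by rewrite mulr_ge0.
rewrite big_split/= -mulr_suml -mulr_sumr mulrDl mul1r.
apply: lerD; first by rewrite ler_pdivrMr// -expr2.
by rewrite mulrC ler_wpM2r// ltW.
Qed.
End trace.

(** * The finite-dimensional Hilbert spaces l2(J) *)

(** These spaces serve [classical_quantum], where finite mixtures of deterministic points are
    exhibited as quantum strategies. *)
Definition l2 (R : realType) (J : finType) := {ffun J -> R[i]}.
HB.instance Definition _ (R : realType) (J : finType) :=
  GRing.Lmodule.copy (l2 R J) {ffun J -> R[i]^o}.
HB.instance Definition _ (R : realType) (J : finType) :=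
  Vector.copy (l2 R J) {ffun J -> R[i]^o}.

Section l2.
Context {R : realType} {J : finType}.
Implicit Types u v : l2 R J.
Definition l2dot u v : R[i] := \sum_j u j * (v j)^*.
Lemma l2dot_is_bilinear : bilinear_for *%R (Num.conj \; *%R) l2dot.
Proof.
split=> [v c u w|u c v w] /=; rewrite /l2dot /=.
  rewrite mulr_sumr -big_split/=; apply: eq_bigr => j _.
  by rewrite !ffunE /GRing.scale /= mulrDl mulrA.
rewrite mulr_sumr -big_split/=; apply: eq_bigr => j _.
rewrite !ffunE /GRing.scale /= rmorphD rmorphM/=. ring.
Qed.
HB.instance Definition _ := bilinear_isBilinear.Build R[i] (l2 R J) (l2 R J) R[i]
  *%R (Num.conj \; *%R) l2dot l2dot_is_bilinear.

Lemma l2dotC u v : l2dot u v = (-1) ^+ false * Num.conj (l2dot v u).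
Proof.
rewrite expr0 mul1r /l2dot rmorph_sum /=; apply: eq_bigr => j _.
by rewrite rmorphM /= conjCK mulrC.
Qed.
HB.instance Definition _ := isHermitianSesquilinear.Build R[i] (l2 R J)
  false (@Num.conj R[i]) l2dot l2dotC.

Lemma l2dot_gt0 u : u != 0 -> 0 < l2dot u u.
Proof.
move=> u0; have h j : true -> 0 <= u j * (u j)^* by rewrite mul_conjC_ge0.
rewrite lt_def sumr_ge0// andbT; apply: contra u0 => /eqP e; apply/eqP/ffunP => j.
have /eqP := psumr_eq0P h e (i:=j) isT.
by rewrite mul_conjC_eq0 ffunE => /eqP.
Qed.
HB.instance Definition _ := isDotProduct.Build R[i] (l2 R J) l2dot l2dot_gt0.

Definition l2norm u : R[i] := sqrtC (l2dot u u).
Lemma l2normD u v : l2norm (u + v) <= l2norm u + l2norm v.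
Proof. exact: (triangle_lerif (l2dot : {dot l2 R J for Num.conj}) u v).1. Qed.
Lemma l2normZ c u : l2norm (c *: u) = `|c| * l2norm u.
Proof.
rewrite /l2norm (dnormZ (l2dot : {dot l2 R J for Num.conj})) sqrtCM ?qualifE/= ?exprn_ge0//.
  by rewrite sqrCK.
exact: (dnorm_ge0 (l2dot : {dot l2 R J for Num.conj})).
Qed.
Lemma l2norm0 u : l2norm u = 0 -> u = 0.
Proof.
move=> /eqP; rewrite sqrtC_eq0 => u0; apply/eqP; apply: contraLR u0 => /l2dot_gt0.
by rewrite lt_def => /andP[].
Qed.
HB.instance Definition _ := Lmodule_isNormed.Build R[i] (l2 R J) l2normD l2normZ l2norm0.

Lemma l2normE u : `|u| = l2norm u. Proof. by []. Qed.

Lemma l2coord_le u j : `|u j| <= `|u|.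
Proof.
rewrite l2normE /l2norm -[leLHS]sqrCK// ler_sqrtC ?qualifE/= ?exprn_ge0//; last first.
  exact: (dnorm_ge0 (l2dot : {dot l2 R J for Num.conj})).
rewrite normCK /l2dot (bigD1 j)//= lerDl sumr_ge0// => i _.
exact: mul_conjC_ge0.
Qed.

Lemma l2norm_le u : `|u| <= \sum_j `|u j|.
Proof.
pose d j : l2 R J := [ffun k => (k == j)%:R].
have {1}-> : u = \sum_j u j *: d j.
  apply/ffunP => k; rewrite sum_ffunE (bigD1 k)//= big1 => [|i ik].
    by rewrite !ffunE eqxx /GRing.scale/= mulr1 addr0.
  by rewrite !ffunE eq_sym (negbTE ik) /GRing.scale/= mulr0.
apply: le_trans (ler_norm_sum _ _ _) _; apply: ler_sum => j _.
rewrite normrZ l2normE /l2norm /l2dot (bigD1 j)//= big1 => [|i ij].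
  by rewrite !ffunE eqxx conjC_nat !mulr1 addr0 sqrtC1 mulr1.
by rewrite !ffunE (negbTE ij) mul0r.
Qed.

(** Real and imaginary parts of coordinates are 1-Lipschitz, so they converge along [F]; the norm is
    recovered from the coordinates by [l2norm_le]. *)
Lemma l2_complete (F : set_system (l2 R J)) : ProperFilter F -> cauchy F -> cvg F.
Proof.
move=> FF /cauchyP Fc.
have key (g : l2 R J -> R) : (forall u v, `|g u - g v|%:C <= `|u - v|) ->
    exists a : R, g @ F --> a.
  move=> gl; suff /cvg_ex : cvg (g @ F) by [].
  pose FF' := fmap_proper_filter g FF; apply: (R_complete (F := g @ F)).
  apply/cauchyP => e e0; have := Fc e%:C; rewrite ltcR => /(_ e0)[u Fu].
  exists (g u); rewrite /fmap /=; apply: filterS Fu => v.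
  rewrite -!ball_normE/= => uv; rewrite -ltcR.
  exact: le_lt_trans (gl u v) uv.
have /choice[a ha] : forall j, exists a : R, (fun u => complex.Re (u j)) @ F --> a.
  move=> j; apply: key => u v; apply: le_trans (l2coord_le _ j).
  rewrite !ffunE normc_def lecR -sqrtr_sqr ler_sqrt; last by rewrite addr_ge0// sqr_ge0.
  by case: (u j) (v j) => [? ?] [? ?] /=; rewrite lerDl sqr_ge0.
have /choice[b hb] : forall j, exists a : R, (fun u => complex.Im (u j)) @ F --> a.
  move=> j; apply: key => u v; apply: le_trans (l2coord_le _ j).
  rewrite !ffunE normc_def lecR -sqrtr_sqr ler_sqrt; last by rewrite addr_ge0// sqr_ge0.
  by case: (u j) (v j) => [? ?] [? ?] /=; rewrite lerDr sqr_ge0.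
pose l : l2 R J := [ffun j => a j +i* b j].
apply/cvg_ex; exists l; apply/cvgrPdist_le => e e0.
(* [n] is positive even if [J] is empty; e / (2 n) leaves room for two real coordinates per
   index. *)
have [n n0 nJ] : exists2 n : R, 0 < n & #|J|%:R <= n.
  by exists #|J|.+1%:R; rewrite ?ltr0n ?ler_nat.
have er : e = (complex.Re e)%:C by rewrite RRe_real// gtr0_real.
have d0 : 0 < complex.Re e / (2 * n).
  by rewrite divr_gt0 ?mulr_gt0// -ltcR -er.
near=> u.
have h1 : forall j, `|a j - complex.Re (u j)| <= complex.Re e / (2 * n).
  by near: u; apply: filter_forall => j; have /cvgrPdist_le := ha j; exact.
have h2 : forall j, `|b j - complex.Im (u j)| <= complex.Re e / (2 * n).
  by near: u; apply: filter_forall => j; have /cvgrPdist_le := hb j; exact.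
apply: le_trans (l2norm_le _) _.
have : forall j, `|(l - u) j| <= (complex.Re e / n)%:C.
  move=> j.
  have -> : (l - u) j = (a j - complex.Re (u j))%:C + 'i%C * (b j - complex.Im (u j))%:C.
    by rewrite !ffunE; case: (u j) => p q /=; simpc.
  apply: le_trans (ler_normD _ _) _; rewrite normrM !normc_def/=.
  rewrite !(expr0n,expr1n,addr0,add0r,sqrtr1,mul1r) !sqrtr_sqr -rmorphD/= lecR.
  have -> : complex.Re e / n = complex.Re e / (2 * n) + complex.Re e / (2 * n).
    have nn : n != 0 by rewrite gt_eqF.
    by field; rewrite nn.
  exact: lerD (h1 j) (h2 j).
move=> h; apply: (@le_trans _ _ (\sum_(j : J) (complex.Re e / n)%:C)).
  by apply: ler_sum => j _; exact: h.
rewrite -rmorph_sum/= sumr_const er lecR -[_ *+ _]mulr_natr -mulrA ler_piMr//.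
  by rewrite -lecR -er ltW.
by rewrite mulrC ler_pdivrMr// mul1r.
Unshelve. all: by end_near. Qed.

HB.instance Definition _ := Uniform_isComplete.Build (l2 R J) l2_complete.
Lemma l2inner_norm u : l2dot u u = `|u| ^+ 2.
Proof. by rewrite l2normE sqrtCK. Qed.
HB.instance Definition _ := isHilbert.Build R (l2 R J) l2inner_norm.
Definition l2H : hilbertType R := l2 R J.
End l2.
Arguments l2H : clear implicits.

(** * Tensor products of operators *)

Section bounded.
Context {R : realType} {H : hilbertType R}.
Implicit Types (S T : {linear H -> H}).

Lemma bounded_sum (I : Type) (r : seq I) (P : pred I) (F : I -> {linear H -> H})
    (T : {linear H -> H}) :
  (forall i, P i -> bounded_op (F i)) ->
  (forall v, T v = \sum_(i <- r | P i) F i v) -> bounded_op T.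
Proof.
move=> bF TE; suff [k k0 hk] : exists2 k, 0 <= k &
    forall v, `|\sum_(i <- r | P i) F i v| <= k * `|v|.
  by apply: (le_bounded k0) => v; rewrite TE.
elim: r {TE} => [|i r [k k0 hk]].
  by exists 0 => // v; rewrite big_nil normr0 mul0r.
have [Pi|nPi] := boolP (P i); last by exists k => // v; rewrite big_cons (negbTE nPi).
have [l l0 hl] := bounded_le (bF i Pi).
exists (l + k) => [|v]; first by rewrite addr_ge0// ltW.
rewrite big_cons Pi; apply: le_trans (ler_normD _ _) _.
by rewrite mulrDl lerD.
Qed.

Lemma bounded_comp S T : bounded_op S -> bounded_op T -> bounded_op (S \o T).
Proof.
move=> /bounded_le[k k0 hk] /bounded_le[l l0 hl].
apply: (@le_bounded _ _ _ (k * l)) => [|v /=]; first by rewrite mulr_ge0// ltW.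
by apply: le_trans (hk _) _; rewrite -mulrA ler_wpM2l// ltW.
Qed.

Lemma bounded_add S T : bounded_op S -> bounded_op T -> bounded_op (S \+ T).
Proof.
move=> /bounded_le[k k0 hk] /bounded_le[l l0 hl].
apply: (@le_bounded _ _ _ (k + l)) => [|v /=]; first by rewrite addr_ge0// ltW.
by apply: le_trans (ler_normD _ _) _; rewrite mulrDl lerD.
Qed.

Lemma bounded_id : bounded_op (idfun : {linear H -> H}).
Proof. by apply: (@le_bounded _ _ _ 1) => // v; rewrite mul1r. Qed.
End bounded.

Section sum_op.
Context {K : pzRingType} {V : lmodType K}.
Definition sum_op (I : finType) (P : pred I) (F : I -> {linear V -> V}) : V -> V :=
  fun v => \sum_(i | P i) F i v.
Lemma sum_op_is_linear (I : finType) (P : pred I) (F : I -> {linear V -> V}) :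
  linear (sum_op P F).
Proof.
move=> c u v; rewrite /sum_op scaler_sumr -big_split/=; apply: eq_bigr => i _.
by rewrite linearP.
Qed.
HB.instance Definition _ (I : finType) (P : pred I) (F : I -> {linear V -> V}) :=
  GRing.isLinear.Build _ _ _ _ (sum_op P F) (sum_op_is_linear P F).
End sum_op.

Section tensor.
Context {R : realType} {n : nat} {H : 'I_n -> hilbertType R} {K : tensorProduct H}.
Implicit Types (x y z : forall i, H i) (S T : {linear K -> K}) (i j : 'I_n).

Lemma ip_tens x y : ip (tens K x) (tens K y) = \prod_(i < n) ip (x i) (y i).
Proof. exact: tens_inner. Qed.

Lemma tens_approx (v : K) (e : R[i]) : 0 < e ->
  exists2 d, lin_span (range (tens K)) d & `|v - d| < e.
Proof. by move=> e0; apply: closure_approx => //; exact: tens_total. Qed.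

Lemma lin_span_ind (V : lmodType R[i]) (A : set V) (P : V -> Prop) :
  (forall a, A a -> P a) -> P 0 -> (forall c u v, P u -> P v -> P (c *: u + v)) ->
  forall v, lin_span A v -> P v.
Proof.
move=> PA P0 PD v [m [c [u [hu ->]]]]; elim/big_ind : _ => //.
  by move=> a b Pa Pb; rewrite -[a]scale1r; exact: PD.
by move=> j _; rewrite -[_ *: _]addr0; apply: PD => //; apply: PA.
Qed.

Lemma tens_op_ext S T : bounded_op S -> bounded_op T ->
  (forall x, S (tens K x) = T (tens K x)) -> forall v, S v = T v.
Proof.
move=> bS bT ST v; have [k k0 hk] := bounded_le bS; have [l l0 hl] := bounded_le bT.
have Sd d : lin_span (range (tens K)) d -> S d = T d.
  move: d; apply: lin_span_ind => [_ [x _ <-]//||c u w Su Sw]; first by rewrite !linear0.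
  by rewrite !linearP Su Sw.
apply/eqP; rewrite -subr_eq0 -normr_eq0; apply/eqP.
apply: eq_approx => e e0; rewrite subr0 normr_id.
have kl0 : 0 < k + l by rewrite addr_gt0.
have [d hd hvd] := tens_approx v (divr_gt0 e0 kl0).
have -> : S v - T v = S (v - d) - T (v - d).
  by rewrite (linearB S) (linearB T) (Sd d hd) opprB addrA subrK.
apply: le_lt_trans (ler_normB _ _) _.
apply: (@le_lt_trans _ _ ((k + l) * `|v - d|)).
  by rewrite mulrDl lerD.
by rewrite mulrC -ltr_pdivlMr.
Qed.

Lemma tens_ip_ext (u v : K) :
  (forall y, ip u (tens K y) = ip v (tens K y)) -> u = v.
Proof.
move=> uv; apply/eqP; rewrite -subr_eq0; apply/eqP; set w := u - v.
have wd d : lin_span (range (tens K)) d -> ip w d = 0.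
  move: d; apply: lin_span_ind => [_ [x _ <-]||c a b wa wb].
  - by rewrite innerBl uv subrr.
  - by rewrite inner0r.
  - by rewrite innerDr innerZr wa wb mulr0 addr0.
clearbody w; apply: inner_eq0; apply: eq_approx => e e0; rewrite subr0.
have w0 : 0 < `|w| + 1 by rewrite ltr_wpDl.
have [d hd hvd] := tens_approx w (divr_gt0 e0 w0).
have -> : ip w w = ip w (w - d) by rewrite innerBr (wd d hd) subr0.
apply: le_lt_trans (inner_CS _ _) _.
apply: (@le_lt_trans _ _ ((`|w| + 1) * `|w - d|)).
  by rewrite ler_wpM2r// lerDl.
by rewrite mulrC -ltr_pdivlMr.
Qed.

(* Schur's product theorem: Cholesky splits one factor into rank-one kernels,
   which are absorbed into the coefficients c. *)
Lemma schur_product (M : forall i, {linear H i -> H i}) (m : nat)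
    (x : 'I_m -> forall i, H i) (s : seq 'I_n) (c : 'I_m -> R[i]) :
  (forall i, positive_op (M i)) ->
  0 <= \sum_k \sum_l c k * (c l)^* * \prod_(i <- s) ip (M i (x k i)) (x l i).
Proof.
move=> pM; elim: s c => [|i s IH] c.
  under eq_bigr do under eq_bigr do rewrite big_nil mulr1.
  under eq_bigr do rewrite -mulr_sumr.
  by rewrite -mulr_suml -rmorph_sum/= mul_conjC_ge0.
have [ps [B [_ ME Bx]]] := cholesky [seq x k i | k <- enum 'I_m] (pM i).
have {}ME k l : ip (M i (x k i)) (x l i) =
    \sum_(p <- ps) ip (x k i) p * (ip (x l i) p)^*.
  rewrite ME Bx ?addr0; last by apply: map_f; rewrite mem_enum.
  by rewrite inner_suml; apply: eq_bigr => p _; rewrite /rank1 innerZl (innerC p).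
have -> : \sum_k \sum_l c k * (c l)^* *
      \prod_(i0 <- i :: s) ip (M i0 (x k i0)) (x l i0) =
    \sum_(p <- ps) \sum_k \sum_l (c k * ip (x k i) p) * (c l * ip (x l i) p)^* *
      \prod_(i0 <- s) ip (M i0 (x k i0)) (x l i0).
  rewrite [RHS]exchange_big/=; apply: eq_bigr => k _.
  rewrite [RHS]exchange_big/=; apply: eq_bigr => l _.
  rewrite big_cons ME mulrA mulr_sumr mulr_suml; apply: eq_bigr => p _.
  rewrite rmorphM/=. ring.
by apply: sumr_ge0 => p _; exact: IH.
Qed.

(** On finite sums of elementary tensors this is Schur's product theorem; boundedness carries it to
    the closure. *)
Lemma tensor_op_positive (A : forall i, {linear H i -> H i}) T :
  (forall i, positive_op (A i)) -> is_tensor_op A T -> positive_op T.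
Proof.
move=> pA [bT TE]; have [k k0 hk] := bounded_le bT.
have Td d : lin_span (range (tens K)) d -> 0 <= ip (T d) d.
  move=> [m [c [u [hu ->]]]].
  have /choice[x hx] : forall l, exists x, tens K x = u l.
    by move=> l; have [x _ <-] := hu l; exists x.
  rewrite linear_sum inner_suml.
  have := schur_product x (index_enum 'I_n) c pA; congr (0 <= _).
  apply: eq_bigr => a _; rewrite inner_sumr; apply: eq_bigr => b _.
  by rewrite linearZ innerZl innerZr -!hx TE ip_tens mulrA.
apply: positiveI => v; apply: ge0_approx => e e0.
(* A Lipschitz constant for w -> <T w, w> between v and a point d with |d| <= |v| + 1. *)
pose C := k * (2 * `|v| + 1).
have C0 : 0 < C by rewrite mulr_gt0// ltr_wpDl// mulr_ge0.
have [|d hd] := @tens_approx v (Num.min 1 (e / C)).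
  by rewrite comparable_lt_min ?ltr01 ?divr_gt0// real_comparable ?ger0_real ?divr_ge0// ltW.
rewrite comparable_lt_min; last by rewrite real_comparable ?ger0_real ?divr_ge0// ltW.
move=> /andP[d1 d2]; exists (ip (T d) d); first exact: Td.
have -> : ip (T v) v - ip (T d) d = ip (T (v - d)) v + ip (T d) (v - d).
  by rewrite linearB innerBl innerBr addrA subrK.
apply: le_lt_trans (ler_normD _ _) _.
have dv : `|d| <= `|v| + 1.
  by rewrite -[d](subKr v); apply: le_trans (ler_normB _ _) _; rewrite lerD2l ltW.
apply: (@le_lt_trans _ _ (C * `|v - d|)); last by rewrite mulrC -ltr_pdivlMr.
have -> : C * `|v - d| = k * `|v - d| * `|v| + k * (`|v| + 1) * `|v - d|.
  by rewrite /C; ring.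
apply: lerD; apply: le_trans (inner_CS _ _) _; first by rewrite ler_wpM2r.
rewrite ler_wpM2r//; apply: le_trans (hk _) _.
by rewrite ler_wpM2l// ltW.
Qed.

Definition local_op (j : 'I_n) (A : {linear H j -> H j}) T :=
  bounded_op T /\ forall y, T (tens K y) = tens K (dfwith y j (A (y j))).

Lemma eq_tens x y : (forall i, x i = y i) -> tens K x = tens K y.
Proof. by move=> h; congr (tens K _); exact: functional_extensionality_dep. Qed.

Lemma dfwith_same (y : forall i, H i) j : dfwith y j (y j) = y.
Proof.
apply: functional_extensionality_dep => i; have [->|ij] := eqVneq i j.
  by rewrite dfwithin.
by rewrite dfwithout// eq_sym.
Qed.

Section local.
Variable j : 'I_n.
Implicit Types (A B : {linear H j -> H j}).

Lemma local_op_unique A S T : local_op A S -> local_op A T -> forall v, S v = T v.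
Proof. by move=> [bS SE] [bT TE]; apply: tens_op_ext => // x; rewrite SE TE. Qed.

Lemma local_op_comp A B S T : local_op A S -> local_op B T ->
  local_op (A \o B) (S \o T).
Proof.
move=> [bS SE] [bT TE]; split=> [|y]; first exact: bounded_comp.
rewrite /= TE SE; apply: eq_tens => i; have [->|ij] := eqVneq i j.
  by rewrite !dfwithin.
by rewrite !dfwithout// eq_sym.
Qed.

Lemma local_op_add A B S T : local_op A S -> local_op B T ->
  local_op (A \+ B) (S \+ T).
Proof.
move=> [bS SE] [bT TE]; split=> [|y]; first exact: bounded_add.
rewrite /= TE SE.
by have := tens_linear K y (i := j) 1 (A (y j)) (B (y j)); rewrite !scale1r => ->.
Qed.

Lemma local_op_positive A T : positive_op A -> local_op A T -> positive_op T.
Proof.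
move=> pA [bT TE].
pose M := dfwith (T := fun i => {linear H i -> H i}) (fun i => idfun) j A.
apply: (@tensor_op_positive M) => [i|].
  rewrite /M; have [->|ij] := eqVneq i j; first by rewrite dfwithin.
  by rewrite dfwithout 1?eq_sym//; exact: idfun_positive.
split=> // y; rewrite TE; apply: eq_tens => i; rewrite /M.
have [->|ij] := eqVneq i j; first by rewrite !dfwithin.
by rewrite !dfwithout// eq_sym.
Qed.

(** A product operator over the other parties, with the identity at [j]; the form taken by the joint
    effect of all parties but [j]. *)
Definition trivial_at (T : {linear K -> K}) :=
  bounded_op T /\ exists M : forall i, {linear H i -> H i},
  forall y, T (tens K y) = tens K (dfwith (fun i => M i (y i)) j (y j)).

Lemma local_op_comm A S T : local_op A S -> trivial_at T ->
  forall v, S (T v) = T (S v).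
Proof.
move=> [bS SE] [bT [M TE]].
apply: (@tens_op_ext (S \o T) (T \o S)) => [||y /=]; try exact: bounded_comp.
rewrite SE !TE SE; apply: eq_tens => i; have [->|ij] := eqVneq i j.
  by rewrite !dfwithin.
by rewrite !dfwithout// eq_sym.
Qed.
End local.
End tensor.

(** * Quantum correlations and their extreme points *)

Lemma sumZ2 (V : nmodType) (F : 'Z_2 -> V) : \sum_(a : 'Z_2) F a = F 0 + F 1.
Proof.
rewrite big_ord_recl big_ord1; congr (F _ + F _); exact: val_inj.
Qed.

Lemma Z2P (a : 'Z_2) : a = 0 \/ a = 1.
Proof.
by case: a => -[|[|//]] h; [left|right]; exact: val_inj.
Qed.

Definition upd (n : nat) (a : bits n) (j : 'I_n) (b : 'Z_2) : bits n :=
  [ffun i => if i == j then b else a i].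

Definition measurement (R : realType) (n : nat) (H : 'I_n -> hilbertType R) :=
  forall i, 'Z_2 -> 'Z_2 -> {linear H i -> H i}.

Definition povms (R : realType) (n : nat) (H : 'I_n -> hilbertType R)
  (M : measurement H) := forall i x, povm (M i x).

Definition tensor_ops (R : realType) (n : nat) (H : 'I_n -> hilbertType R)
    (K : tensorProduct H) (M : measurement H)
    (T : bits n -> bits n -> {linear K -> K}) :=
  forall a x : bits n, is_tensor_op (fun i => M i (x i) (a i)) (T a x).

(** * Effects of one party and of all the others *)

Section effects.
Context {R : realType} {n : nat} {H : 'I_n -> hilbertType R} {K : tensorProduct H}.
Context {M : measurement H} {T : bits n -> bits n -> {linear K -> K}}.
Hypothesis hM : povms M.
Hypothesis hT : tensor_ops M T.
Implicit Types (a x : bits n) (i j : 'I_n) (b : 'Z_2) (y z : forall i, H i).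

Lemma M_sum i b v : M i b 0 v + M i b 1 v = v.
Proof. by have [_ _ /(_ v)] := hM i b; rewrite sumZ2. Qed.

Lemma M_positive i b c : positive_op (M i b c).
Proof. by have [_ h _] := hM i b; exact: h. Qed.

Lemma M_bounded i b c : bounded_op (M i b c).
Proof. by have [h _ _] := hM i b; exact: h. Qed.

Lemma T_positive a x : positive_op (T a x).
Proof. by apply: (tensor_op_positive _ (hT a x)) => i; exact: M_positive. Qed.

Lemma T_bounded a x : bounded_op (T a x).
Proof. exact: (hT a x).1. Qed.

(** Distributivity of a product of sums over outcome strings, tested against elementary tensors.
    Restricting one party by [Q], or none, gives the single-party operators and the resolution of
    the identity. *)
Lemma sum_T_tens (Q : forall i, pred 'Z_2) x y :
  \sum_(a | a \in family Q) T a x (tens K y) =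
  tens K (fun i => \sum_(b | Q i b) M i (x i) b (y i)).
Proof.
apply: tens_ip_ext => z; rewrite inner_suml ip_tens.
under [RHS]eq_bigr do rewrite inner_suml.
rewrite bigA_distr_big_dep; apply: eq_bigr => a _.
by rewrite (hT a x).2 ip_tens.
Qed.

(* The operator M j (x j) b tensored with identities; summing the given tensor
   operators avoids constructing tensor products of operators. *)
Definition effect_op j x b : K -> K := sum_op (fun a => a j == b) (fun a => T a x).
HB.instance Definition _ j x b := GRing.Linear.on (effect_op j x b).

Lemma effect_op_bounded j x b : bounded_op (effect_op j x b).
Proof.
by apply: (@bounded_sum _ _ _ _ _ (fun a => T a x)) => [a _|v]; [exact: T_bounded|].
Qed.

Lemma effect_op_local j x b : local_op (M j (x j) b) (effect_op j x b).
Proof.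
split=> [|y]; first exact: effect_op_bounded.
pose Q i := [pred c : 'Z_2 | (i == j) ==> (c == b)].
rewrite [LHS](_ : _ = \sum_(a | a \in family Q) T a x (tens K y)); last first.
  apply: eq_bigl => a /=; apply/idP/familyP => [/eqP ab i|/(_ j)].
    by rewrite inE; apply/implyP => /eqP ->; rewrite ab.
  by rewrite inE eqxx.
rewrite sum_T_tens; apply: eq_tens => i; have [->|ij] := eqVneq i j.
  by rewrite dfwithin (big_pred1 b) // => c; rewrite /= eqxx.
rewrite dfwithout 1?eq_sym// (eq_bigl xpredT) ?sumZ2 ?M_sum// => c.
by rewrite /= (negbTE ij).
Qed.

Lemma effect_op_positive j x b : positive_op (effect_op j x b).
Proof. exact: (local_op_positive (M_positive (x j) b) (effect_op_local j x b)). Qed.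

Lemma effect_op_eq j x x' b v : x j = x' j -> effect_op j x b v = effect_op j x' b v.
Proof.
move=> e; apply: (local_op_unique (effect_op_local j x b)).
by rewrite e; exact: effect_op_local.
Qed.

Lemma sum_T x v : \sum_a T a x v = v.
Proof.
apply: (@tens_op_ext _ _ _ _ (sum_op xpredT (fun a => T a x)) idfun) => [||y].
- by apply: (@bounded_sum _ _ _ _ _ (fun a => T a x)) => [a _|//]; exact: T_bounded.
- exact: bounded_id.
rewrite [LHS](_ : _ = \sum_(a | a \in family (fun=> xpredT)) T a x (tens K y)); last first.
  by apply: eq_bigl => a; apply/esym/familyP => i.
by rewrite sum_T_tens; apply: eq_tens => i; rewrite sumZ2 M_sum.
Qed.

Lemma effect_op_sum j x v : effect_op j x 0 v + effect_op j x 1 v = v.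
Proof.
rewrite -[RHS](sum_T x v) (bigID (fun a : bits n => a j == 0))/=; congr (_ + _).
by apply: eq_bigl => a; case: (Z2P (a j)) => ->.
Qed.

Lemma T_contraction a x v : ip (T a x v) v <= ip v v.
Proof.
rewrite -[X in _ <= ip X _](sum_T x v) inner_suml (bigD1 a)//= lerDl sumr_ge0// => c _.
by apply: positiveP; exact: T_positive.
Qed.

(* The product of the effects of all parties but j. *)
Definition rest_op j a x : K -> K := sum_op xpredT (fun b => T (upd a j b) x).
HB.instance Definition _ j a x := GRing.Linear.on (rest_op j a x).

Lemma rest_op_tens j a x y : rest_op j a x (tens K y) =
  tens K (dfwith (fun i => M i (x i) (a i) (y i)) j (y j)).
Proof.
apply: tens_ip_ext => z; rewrite /rest_op /sum_op inner_suml ip_tens [RHS](bigD1 j)//=.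
have -> : ip (dfwith (fun i => M i (x i) (a i) (y i)) j (y j) j) (z j) =
    ip (M j (x j) 0 (y j)) (z j) + ip (M j (x j) 1 (y j)) (z j).
  by rewrite dfwithin -innerDl M_sum.
rewrite mulrDl sumZ2.
have h b : ip (T (upd a j b) x (tens K y)) (tens K z) = ip (M j (x j) b (y j)) (z j) *
   \prod_(i < n | i != j) ip (dfwith (fun i => M i (x i) (a i) (y i)) j (y j) i) (z i).
  rewrite (hT _ x).2 ip_tens (bigD1 j)//= ffunE eqxx; congr (_ * _).
  by apply: eq_bigr => i ij; rewrite ffunE (negbTE ij) dfwithout// eq_sym.
by rewrite !h.
Qed.

Lemma rest_op_bounded j a x : bounded_op (rest_op j a x).
Proof.
by apply: (@bounded_sum _ _ _ _ _ (fun b => T (upd a j b) x)) => [b _|v] //;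
  exact: T_bounded.
Qed.

Lemma rest_op_trivial j a x : trivial_at j (rest_op j a x).
Proof.
split; first exact: rest_op_bounded.
by exists (fun i => M i (x i) (a i)) => y; exact: rest_op_tens.
Qed.

Lemma rest_op_positive j a x : positive_op (rest_op j a x).
Proof.
apply: positiveI => v; rewrite /rest_op /sum_op inner_suml sumr_ge0// => b _.
by apply: positiveP; exact: T_positive.
Qed.

Lemma T_factor j a x v : T a x v = effect_op j x (a j) (rest_op j a x v).
Proof.
apply: (@tens_op_ext _ _ _ _ _ (effect_op j x (a j) \o rest_op j a x)) => [||y /=].
- exact: T_bounded.
- by apply: bounded_comp; [exact: effect_op_bounded|exact: rest_op_bounded].
rewrite (hT a x).2 rest_op_tens (effect_op_local j x (a j)).2; apply: eq_tens => i.
have [->|ij] := eqVneq i j; first by rewrite !dfwithin.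
by rewrite !dfwithout// eq_sym.
Qed.

Lemma rest_op_eq j a a' x x' v :
  (forall i, i != j -> a i = a' i /\ x i = x' i) -> rest_op j a x v = rest_op j a' x' v.
Proof.
move=> h; apply: (@tens_op_ext _ _ _ _ (rest_op j a x) (rest_op j a' x')) => [||y /=];
  try exact: rest_op_bounded.
rewrite !rest_op_tens; apply: eq_tens => i; have [->|ij] := eqVneq i j.
  by rewrite !dfwithin.
have ji : j != i by rewrite eq_sym.
by rewrite !dfwithout//; have [-> ->] := h i ij.
Qed.

Lemma effect_op_rest j a x x' b v :
  effect_op j x' b (rest_op j a x v) = rest_op j a x (effect_op j x' b v).
Proof. exact: (local_op_comm (effect_op_local j x' b) (rest_op_trivial j a x)). Qed.

(** The competing measurements played against an extreme point come from such a change of one party.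
    The new joint operators act on the same tensor product, so old and new strategies can be applied
    to the same vectors. *)
Lemma replace_party j (B : 'Z_2 -> 'Z_2 -> {linear H j -> H j})
    (Bh : 'Z_2 -> 'Z_2 -> {linear K -> K}) :
  (forall xi, povm (B xi)) -> (forall xi b, local_op (B xi b) (Bh xi b)) ->
  povms (dfwith M j B : measurement H) /\
  tensor_ops (dfwith M j B : measurement H) (fun a x => Bh (x j) (a j) \o rest_op j a x).
Proof.
move=> pB lB; split=> [i xi|a x].
  have [->|ij] := eqVneq i j; first by rewrite dfwithin.
  by rewrite dfwithout 1?eq_sym.
split=> [|y]; first by apply: bounded_comp; [exact: (lB _ _).1|exact: rest_op_bounded].
rewrite /= rest_op_tens (lB _ _).2; apply: eq_tens => i; have [->|ij] := eqVneq i j.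
  by rewrite !dfwithin.
by rewrite !dfwithout// eq_sym.
Qed.

Lemma pure_quantum (psi : K) (q : corr R n) : ip psi psi = 1 ->
  (forall a x, (q (a, x))%:C = ip (T a x psi) psi) -> quantum_set R n q.
Proof.
move=> psi1 hq.
have hd : density_op (rank1 psi).
  split; [exact: rank1_bounded|exact: rank1_positive|].
  by have := @rank1_has_trace _ _ psi; rewrite psi1.
exists (QuantumStrategy hd hM) => a x; exists (T a x); split; first exact: hT.
by rewrite hq; exact: (rank1_trace (psi := psi) (T_positive a x)).
Qed.

End effects.

(** * Consequences of extremality *)

Section quantum.
Context {R : realType} {n : nat}.
Implicit Types (q p : corr R n) (a x : bits n).

Lemma realizes_ops (S : quantumStrategy R n) q : realizes S q ->
  exists2 T : bits n -> bits n -> {linear qtensor S -> qtensor S},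
    tensor_ops (@qmeas _ _ S : measurement _) T &
    forall a x, has_trace (@qstate _ _ S \o T a x) (q (a, x))%:C.
Proof.
move=> hq.
have /choice[T hT] : forall s : bits n * bits n,
    exists T : {linear qtensor S -> qtensor S},
      is_tensor_op (fun i => qmeas S i (s.2 i) (s.1 i)) T /\
      has_trace (@qstate _ _ S \o T) (q (s.1, s.2))%:C.
  by move=> s; exact: hq.
exists (fun a x => T (a, x)) => a x; first exact: (hT (a, x)).1.
exact: (hT (a, x)).2.
Qed.

Lemma quantum_ge0 q a x : quantum_set R n q -> 0 <= q (a, x).
Proof.
move=> [S /realizes_ops[T hT hq]]; have [_ rp rt] := @qstate_density _ _ S.
have hM : povms (@qmeas _ _ S : measurement _) := @qmeas_povm _ _ S.
rewrite -lecR; apply: (trace_mul_ge0 rp rt _ _ (hq a x)).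
- exact: (T_positive hM hT).
- by move=> v; exact: (T_contraction hM hT).
Qed.

Lemma quantum_sum1 q x : quantum_set R n q -> \sum_a q (a, x) = 1.
Proof.
move=> [S /realizes_ops[T hT hq]]; have [_ rp rt] := @qstate_density _ _ S.
have hM : povms (@qmeas _ _ S : measurement _) := @qmeas_povm _ _ S.
apply: complexI; rewrite rmorph_sum rmorph1/=.
apply: (has_trace_unique _ rt).
have := @has_trace_sum _ _ _ (index_enum _) (fun a => @qstate _ _ S \o T a x)
  (fun a => (q (a, x))%:C) (fun a => hq a x).
by apply: eq_has_trace => v /=; rewrite -linear_sum (sum_T hM hT).
Qed.

Lemma corr_combE (t : R) p q s : (t *: p + (1 - t) *: q) s = t * p s + (1 - t) * q s.
Proof. by rewrite !ffunE. Qed.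

Lemma normalize (H : hilbertType R) (u : H) : u != 0 ->
  exists u' : H, ip u' u' = 1 /\
    forall T : {linear H -> H}, ip (T u') u' = ip (T u) u / ip u u.
Proof.
move=> u0; have nu : `|u| != 0 by rewrite normr_eq0.
exists (`|u|^-1 *: u).
have h (w : H) : ip (`|u|^-1 *: w) (`|u|^-1 *: u) = ip w u / ip u u.
  rewrite innerZl innerZr fmorphV/= (CrealP (ger0_real (normr_ge0 u))) [in RHS](ip_normE u).
  by field.
split=> [|T]; last by rewrite linearZ h.
by rewrite h divff// ip_normE sqrf_eq0.
Qed.

Section split.
Context {H : 'I_n -> hilbertType R} {K : tensorProduct H}.
Context {Mu Mv : measurement H} {Tu Tv : bits n -> bits n -> {linear K -> K}}.

(** [u] and [v] are unnormalised states whose squared norms are the weights of a mixture equal to q.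
    A zero vector has weight 0 and no normalisation, hence the separate cases. *)
Lemma ext_split q (u v : K) : povms Mu -> tensor_ops Mu Tu ->
  povms Mv -> tensor_ops Mv Tv -> Ext (quantum_set R n) q ->
  ip u u + ip v v = 1 ->
  (forall a x, (q (a, x))%:C = ip (Tu a x u) u + ip (Tv a x v) v) ->
  forall a x, ip (Tu a x u) u = ip u u * (q (a, x))%:C.
Proof.
move=> hMu hTu hMv hTv [Qq eq] uv hq a x.
have [u0|u0] := eqVneq u 0; first by rewrite u0 !inner0r mul0r.
have [v0|v0] := eqVneq v 0.
  by move: uv; rewrite hq v0 !inner0r !addr0 => ->; rewrite mul1r.
have su : sqn u + sqn v = 1.
  by apply: complexI; rewrite rmorphD/= !sqnE uv.
have pos (w : K) : w != 0 -> 0 < sqn w.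
  move=> w0; rewrite lt_def sqn_ge0 andbT; apply: contra w0 => /eqP w0.
  by apply/eqP; apply: inner_eq0; rewrite -sqnE w0.
have u1 := pos _ u0; have v1 := pos _ v0.
have mk (M : measurement H) (T : bits n -> bits n -> {linear K -> K}) (w : K) :
  povms M -> tensor_ops M T -> w != 0 ->
  exists2 p : corr R n, quantum_set R n p &
    forall a x, (sqn w * p (a, x))%:C = ip (T a x w) w.
  move=> hM hT w0; have [w' [w1 wT]] := normalize w0.
  have e c y : (complex.Re (ip (T c y w') w'))%:C = ip (T c y w') w'.
    by rewrite RRe_real// ger0_real//; apply: positiveP; exact: (T_positive hM hT).
  exists [ffun s => complex.Re (ip (T s.1 s.2 w') w')].
    by apply: (pure_quantum hM hT w1) => c y; rewrite ffunE e.
  move=> c y; rewrite rmorphM/= ffunE/= e wT sqnE mulrC divfK//.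
  by rewrite -sqnE; apply/eqP => /complexI/eqP; rewrite gt_eqF// pos.
have [p Qp hp] := mk _ _ _ hMu hTu u0; have [r Qr hr] := mk _ _ _ hMv hTv v0.
have [|/=|pq _] := eq p r (sqn u) Qp Qr.
- by rewrite u1 -su ltrDl.
- apply/ffunP => -[c y]; rewrite corr_combE; apply: complexI.
  by rewrite hq rmorphD/= hp (_ : 1 - sqn u = sqn v) ?hr// -su addrC addKr.
by rewrite -hp pq rmorphM/= sqnE.
Qed.
End split.

(** With [B = rank1 u] and [c = 1 / (1 - |u|^2)], this is the renormalised rest of the state in
    [ext_pure]. *)
Definition scaled_diff (H : hilbertType R) (c : R[i]) (A B : {linear H -> H}) : H -> H :=
  fun v => c *: (A v - B v).
Lemma scaled_diff_is_linear (H : hilbertType R) c (A B : {linear H -> H}) :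
  linear (scaled_diff c A B).
Proof.
move=> d u v; rewrite /scaled_diff (linearP A) (linearP B) opprD addrACA -scalerBr.
by rewrite scalerDr !scalerA mulrC.
Qed.
HB.instance Definition _ (H : hilbertType R) c (A B : {linear H -> H}) :=
  GRing.isLinear.Build _ _ _ _ (scaled_diff c A B) (scaled_diff_is_linear c A B).

Lemma scaled_diff_bounded (H : hilbertType R) c (A B : {linear H -> H}) :
  bounded_op A -> bounded_op B -> bounded_op (scaled_diff c A B).
Proof.
move=> /bounded_le[k k0 hk] /bounded_le[l l0 hl].
apply: (@le_bounded _ _ _ (`|c| * (k + l))) => [|v /=].
  by rewrite mulr_ge0// addr_ge0// ltW.
rewrite /scaled_diff normrZ -mulrA ler_wpM2l//.
by apply: le_trans (ler_normB _ _) _; rewrite mulrDl lerD.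
Qed.

(* A multiple |u><u| of the rank-one operator peeled off rho splits the state
   into two; by extremality, the pure state u already realizes q. *)
Lemma ext_pure q : Ext (quantum_set R n) q ->
  exists (H : 'I_n -> hilbertType R) (K : tensorProduct H) (M : measurement H)
    (T : bits n -> bits n -> {linear K -> K}) (psi : K),
  [/\ povms M, tensor_ops M T, ip psi psi = 1 &
    forall a x, (q (a, x))%:C = ip (T a x psi) psi].
Proof.
move=> [[S /realizes_ops[T hT hq]] eq]; have [rb rp rt] := @qstate_density _ _ S.
have hM : povms (@qmeas _ _ S : measurement _) := @qmeas_povm _ _ S.
set rho := @qstate _ _ S in rb rp rt hq *.
have [w hw] : exists w, ip (rho w) w != 0.
  apply: contrapT => h; have r0 w : rho w = 0.
    apply: (positive_ker rp); apply/eqP/negPn/negP => hw; apply: h; by exists w.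
  have : (1 : R[i]) = 0.
    apply: (has_trace_unique rt); apply: eq_has_trace has_trace0 => v.
    by rewrite r0.
  by move=> /eqP; rewrite oner_eq0.
have [p pE pp] := rank1_peel rp hw.
(* This factor makes |u|^2 at most 1/2, so the rest of the state has nonzero trace even when rho
   itself has rank one. *)
pose c : R[i] := (sqrtC 2)^-1.
have cc : c * c^* = 2^-1.
  rewrite /c fmorphV/= (CrealP (ger0_real _)) ?sqrtC_ge0// -invfM -expr2.
  by rewrite sqrtCK.
pose u := c *: p.
have uE v : rank1 u v = 2^-1 *: rank1 p v.
  by rewrite /rank1 innerZr !scalerA -cc; congr (_ *: _); ring.
have u0 : u != 0.
  apply/eqP => u0; have : rank1 u w = 0 by rewrite /rank1 u0 scaler0.
  rewrite uE pE divff// scale1r => /eqP; rewrite scaler_eq0 invr_eq0 pnatr_eq0/=.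
  by move=> /eqP rw; move: hw; rewrite rw inner0l eqxx.
have pp1 : ip p p <= 1.
  rewrite -subr_ge0; apply: (has_trace_ge0 (A := rho \- rank1 p)).
    exact: pp.
  exact: (has_traceB rt (@rank1_has_trace _ _ p)).
have uu : ip u u = 2^-1 * ip p p by rewrite innerZl innerZr mulrA cc.
have su0 : 0 < sqn u.
  rewrite lt_def sqn_ge0 andbT; apply: contra u0 => /eqP w0.
  by apply/eqP; apply: inner_eq0; rewrite -sqnE w0.
have su1 : sqn u < 1.
  rewrite -ltcR sqnE uu; apply: (@le_lt_trans _ _ (2^-1 * 1)).
    by rewrite ler_wpM2l// invr_ge0.
  by rewrite mulr1 invf_lt1 ?ltr1n.
have [psi [psi1 psiT]] := normalize u0.
have e a x : (complex.Re (ip (T a x psi) psi))%:C = ip (T a x psi) psi.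
  by rewrite RRe_real// ger0_real//; apply: positiveP; exact: (T_positive hM hT).
pose q1 : corr R n := [ffun s => complex.Re (ip (T s.1 s.2 psi) psi)].
have Qq1 : quantum_set R n q1.
  by apply: (pure_quantum hM hT psi1) => a x; rewrite ffunE e.
pose d : R[i] := ((1 - sqn u)^-1)%:C.
have d0 : 0 <= d by rewrite lecR invr_ge0 subr_ge0 ltW.
have hsd : density_op (scaled_diff d rho (rank1 u)).
  split.
  - by apply: scaled_diff_bounded => //; exact: rank1_bounded.
  - apply: positiveI => v; rewrite /scaled_diff innerZl mulr_ge0//= uE.
    have -> : rho v - 2^-1 *: rank1 p v = 2^-1 *: rho v + 2^-1 *: (rho v - rank1 p v).
      rewrite scalerBr addrA -scalerDl (_ : 2^-1 + 2^-1 = 1 :> R[i]) ?scale1r//.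
      by field.
    rewrite innerDl !innerZl addr_ge0// mulr_ge0 ?invr_ge0//; exact: positiveP.
  have := has_traceZ (c := d) (has_traceB rt (@rank1_has_trace _ _ u)).
  rewrite -sqnE; have -> : d * (1 - (sqn u)%:C) = 1.
    rewrite /d -(rmorph1 (real_complex R)) -rmorphB -rmorphM/= mulVf//.
    by rewrite subr_eq0 eq_sym lt_eqF.
  exact.
pose q2 : corr R n := [ffun s => (q s - sqn u * q1 s) / (1 - sqn u)].
have Qq2 : quantum_set R n q2.
  exists (QuantumStrategy hsd hM) => a x; exists (T a x); split; first exact: hT.
  have := has_traceZ (c := d)
    (has_traceB (hq a x) (rank1_trace (psi := u) (T_positive hM hT a x))).
  have -> : d * ((q (a, x))%:C - ip (T a x u) u) = (q2 (a, x))%:C.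
    rewrite ffunE rmorphM/= mulrC; congr (_ * _).
    rewrite rmorphB rmorphM/=; congr (_ - _).
    rewrite ffunE/= e psiT sqnE mulrC divfK//.
    by rewrite -sqnE; apply/eqP => /complexI/eqP; rewrite gt_eqF.
  exact.
exists (@qspace _ _ S), (@qtensor _ _ S), (@qmeas _ _ S : measurement _), T, psi.
split=> // a x; have [|/=|<- _] := eq q1 q2 (sqn u) Qq1 Qq2.
- by rewrite su0.
- apply/ffunP => s; rewrite corr_combE [q2 s]ffunE.
  have h : 1 - sqn u != 0 by rewrite subr_eq0 eq_sym lt_eqF.
  by field.
- by rewrite ffunE e.
Qed.
End quantum.

Section complementary.
Context {R : realType} {H : hilbertType R} {E F : {linear H -> H}}.
Hypotheses (pE : positive_op E) (pF : positive_op F) (EF : forall v, E v + F v = v).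

Lemma complementary_comm v : E (F v) = F (E v).
Proof. by apply: (addIr (F (F v))); rewrite EF -linearD EF. Qed.

(** As E and F commute and sum to 1, EF = EFE + FEF, and both terms are visibly positive. *)
Lemma complementary_positive : positive_op (E \o F).
Proof.
apply: positiveI => v /=.
have -> : E (F v) = E (F (E v)) + F (E (F v)).
  by rewrite -[in LHS](EF v) !linearD/= (complementary_comm (F v)).
rewrite innerDl (positive_herm pE) (positive_herm pF (E (F v))).
by rewrite addr_ge0//; exact: positiveP.
Qed.

Lemma sqr_positive : positive_op (E \o E).
Proof. by apply: positiveI => v /=; rewrite (positive_herm pE) inner_ge0. Qed.
End complementary.

Lemma add_positive (R : realType) (H : hilbertType R) (E F : {linear H -> H}) :
  positive_op E -> positive_op F -> positive_op (E \+ F).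
Proof.
by move=> pE pF; apply: positiveI => v /=; rewrite innerDl addr_ge0//; exact: positiveP.
Qed.

(* With L = X - Y and L' = 1 - X - Y, one has L (1 - Y) L + L' Y L' = X when X
   and Y are projections; for effects X, Y it is enough that they act as
   projections on psi. *)
Lemma swap_identity (R : realType) (H : hilbertType R) (X Y Yc N : {linear H -> H})
    (psi : H) :
  positive_op X -> positive_op Y -> positive_op N ->
  (forall v, Y v + Yc v = v) ->
  (forall v, X (N v) = N (X v)) -> (forall v, Y (N v) = N (Y v)) ->
  X (X psi) = X psi -> Y (Y psi) = Y psi ->
  ip (Yc (N (X psi - Y psi))) (X psi - Y psi) +
  ip (Y (N (psi - X psi - Y psi))) (psi - X psi - Y psi) = ip (X (N psi)) psi.
Proof.
move=> pX pY pN YYc XN YN XX YY.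
have hX := positive_herm pX; have hY := positive_herm pY; have hN := positive_herm pN.
have YcE v : Yc v = v - Y v by apply/eqP; rewrite eq_sym subr_eq addrC YYc.
rewrite YcE innerBl !(hY (N _)) !linearB/= YY.
rewrite !(innerBl, innerBr).
set P := X psi; set Q := Y psi.
have e1 : ip (N psi) (Y P) = ip (N Q) P by rewrite -YN hY.
have e2 : ip (N Q) (Y P) = ip (N Q) P by rewrite -hY YN YY.
have e3 : ip (N P) P = ip (X (N psi)) psi by rewrite /P -hX XN XX XN.
rewrite e1 e2 -e3. ring.
Qed.

Lemma subBB (V : zmodType) (x a b : V) : (x - a) - (x - b) = b - a.
Proof. by rewrite opprB addrC addrA subrK. Qed.

Lemma subV (V : zmodType) (x a b : V) : x - (x - a) - (x - b) = - (x - a - b).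
Proof. by rewrite subKr !opprB addrCA. Qed.

(** * Extreme points under a change of input of one party *)

Section estimate.
Context {R : realType} {n : nat} {H : 'I_n -> hilbertType R} {K : tensorProduct H}.
Context {M : measurement H} {T : bits n -> bits n -> {linear K -> K}}.
Context {psi : K} {q : corr R n}.
Hypotheses (hM : povms M) (hT : tensor_ops M T) (psi1 : ip psi psi = 1).
Hypothesis hq : forall a x, (q (a, x))%:C = ip (T a x psi) psi.
Hypothesis eq : Ext (quantum_set R n) q.
Implicit Types (a x y : bits n) (j : 'I_n) (b c xi : 'Z_2).

Local Notation effect_op := (@effect_op R n H K T).
Local Notation rest_op := (@rest_op R n H K T).
(** An effect of party [j] depends on the input string through entry [j] alone, so the constant
    string is a canonical representative. *)
Definition cbits xi : bits n := [ffun=> xi].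

Lemma Z2_add11 : 1 + 1 = 0 :> 'Z_2. Proof. exact: val_inj. Qed.

Lemma effect_op_sum' j x b v : effect_op j x b v + effect_op j x (b + 1) v = v.
Proof.
have [->|->] := Z2P b; first by rewrite add0r (effect_op_sum hM hT).
by rewrite Z2_add11 addrC (effect_op_sum hM hT).
Qed.

Lemma M_sum' j xi b v : M j xi b v + M j xi (b + 1) v = v.
Proof.
have [->|->] := Z2P b; first by rewrite add0r (M_sum hM).
by rewrite Z2_add11 addrC (M_sum hM).
Qed.

Lemma Z2_eq c b : (c == b) || (c == b + 1).
Proof. by have [->|->] := Z2P c; have [->|->] := Z2P b. Qed.

Lemma sumZ2' (V : nmodType) (F : 'Z_2 -> V) b : \sum_(c : 'Z_2) F c = F b + F (b + 1).
Proof.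
rewrite sumZ2; have [->|->] := Z2P b; first by rewrite add0r.
by rewrite Z2_add11 addrC.
Qed.

Lemma Z2_neq b : (b + 1 == b) = false.
Proof. by have [->|->] := Z2P b. Qed.

Lemma T_factor' a x j v : T a x v = effect_op j (cbits (x j)) (a j) (rest_op j a x v).
Proof.
by rewrite (T_factor hM hT j) (@effect_op_eq _ _ _ _ _ _ hM hT j x (cbits (x j)))// ffunE.
Qed.

Lemma half_vector : exists u : K, forall A : {linear K -> K},
  ip (A u) u = 2^-1 * ip (A psi) psi.
Proof.
exists ((sqrtC 2)^-1 *: psi) => A; rewrite linearZ/= innerZl innerZr mulrA; congr (_ * _).
rewrite fmorphV/= (CrealP (ger0_real _)) ?sqrtC_ge0// -invfM -expr2.
by rewrite sqrtCK.
Qed.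

Section idempotent.
Variables (j : 'I_n) (x : bits n) (b : 'Z_2).
Let E := M j (x j) b.
Let F := M j (x j) (b + 1).
Let X : {linear K -> K} := effect_op j (cbits (x j)) b.
Let Xc : {linear K -> K} := effect_op j (cbits (x j)) (b + 1).

(** On the input [x j], [B1] has the effects E^2 and 1 - E^2, and [B2] has 1 - F^2 and F^2; their
    average is E, F. The complements are written EF + F and E + EF, sums of positive operators. *)
Let B1 xi c : {linear H j -> H j} := if xi == x j then
  (if c == b then (E \o E : {linear _ -> _}) else (E \o F) \+ F) else M j xi c.
Let Bh1 xi c : {linear K -> K} := if xi == x j then
  (if c == b then (X \o X : {linear _ -> _}) else (X \o Xc) \+ Xc)
  else effect_op j (cbits xi) c.
Let B2 xi c : {linear H j -> H j} := if xi == x j then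
  (if c == b then (E \+ (E \o F) : {linear _ -> _}) else F \o F) else M j xi c.
Let Bh2 xi c : {linear K -> K} := if xi == x j then
  (if c == b then (X \+ (X \o Xc) : {linear _ -> _}) else Xc \o Xc)
  else effect_op j (cbits xi) c.

Let pE : positive_op E := @M_positive _ _ _ _ hM j (x j) b.
Let pF : positive_op F := @M_positive _ _ _ _ hM j (x j) (b + 1).
Let bE : bounded_op E := @M_bounded _ _ _ _ hM j (x j) b.
Let bF : bounded_op F := @M_bounded _ _ _ _ hM j (x j) (b + 1).
Let EFs v : E v + F v = v := @M_sum' j (x j) b v.
Let XXc v : X v + Xc v = v := @effect_op_sum' j (cbits (x j)) b v.

Let lX : local_op E X.
Proof. by have := effect_op_local hM hT j (cbits (x j)) b; rewrite ffunE. Qed.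
Let lXc : local_op F Xc.
Proof. by have := effect_op_local hM hT j (cbits (x j)) (b + 1); rewrite ffunE. Qed.

Let povm_B1 xi : povm (B1 xi).
Proof.
rewrite /B1; case: eqP => _; last exact: hM.
split=> [c|c|v].
- by case: ifP => _; [exact: bounded_comp|apply: bounded_add => //; exact: bounded_comp].
- case: ifP => _; first exact: sqr_positive.
  by apply: add_positive => //; exact: complementary_positive.
- rewrite (sumZ2' _ b) eqxx Z2_neq /= addrA -linearD EFs; exact: EFs.
Qed.

Let povm_B2 xi : povm (B2 xi).
Proof.
rewrite /B2; case: eqP => _; last exact: hM.
split=> [c|c|v].
- by case: ifP => _; [apply: bounded_add => //; exact: bounded_comp|exact: bounded_comp].
- case: ifP => _; last exact: sqr_positive.
  by apply: add_positive => //; exact: complementary_positive.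
- rewrite (sumZ2' _ b) eqxx Z2_neq /= -addrA (complementary_comm EFs) -linearD EFs.
  exact: EFs.
Qed.

Let local_B1 xi c : local_op (B1 xi c) (Bh1 xi c).
Proof.
rewrite /B1 /Bh1; case: eqP => [_|_]; last first.
  by have := effect_op_local hM hT j (cbits xi) c; rewrite ffunE.
case: ifP => _; first exact: local_op_comp.
by apply: local_op_add => //; exact: local_op_comp.
Qed.

Let local_B2 xi c : local_op (B2 xi c) (Bh2 xi c).
Proof.
rewrite /B2 /Bh2; case: eqP => [_|_]; last first.
  by have := effect_op_local hM hT j (cbits xi) c; rewrite ffunE.
case: ifP => _; last exact: local_op_comp.
by apply: local_op_add => //; exact: local_op_comp.
Qed.

(* An effect E is the average of the effects E^2 and 1 - (1 - E)^2. *)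
Lemma effect_op_idem :
  effect_op j (cbits (x j)) b (effect_op j (cbits (x j)) b psi) =
  effect_op j (cbits (x j)) b psi.
Proof.
have [hM1 hT1] := replace_party hM hT povm_B1 local_B1.
have [hM2 hT2] := replace_party hM hT povm_B2 local_B2.
have [u hu] := half_vector.
have uu : ip u u = 2^-1 by rewrite (hu idfun)/= psi1 mulr1.
have avg a y : (q (a, y))%:C =
    ip (Bh1 (y j) (a j) (rest_op j a y u)) u + ip (Bh2 (y j) (a j) (rest_op j a y u)) u.
  rewrite (hu (Bh1 (y j) (a j) \o rest_op j a y)).
  rewrite (hu (Bh2 (y j) (a j) \o rest_op j a y))/=.
  rewrite -mulrDr -innerDl hq (T_factor' a y j).
  suff -> : Bh1 (y j) (a j) (rest_op j a y psi) + Bh2 (y j) (a j) (rest_op j a y psi) =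
    2 *: effect_op j (cbits (y j)) (a j) (rest_op j a y psi).
    by rewrite innerZl mulrA mulVf ?mul1r// pnatr_eq0.
  move: (rest_op j a y psi) => w; rewrite /Bh1 /Bh2.
  have [->|_] := eqVneq (y j) (x j); last by rewrite scaler_nat mulr2n.
  rewrite scaler_nat mulr2n; have := Z2_eq (a j) b; have [->|_] /= := eqVneq (a j) b.
    by move=> _; rewrite -/X addrCA -linearD XXc.
  move=> /eqP ->; rewrite -/Xc (complementary_comm XXc) addrAC -linearD XXc addrC.
  by [].
(* By extremality the strategy with E^2 in place of E realises q itself, so that E and E^2 have the
   same mean in psi. *)
have key a y : ip (Bh1 (y j) (a j) (rest_op j a y psi)) psi = (q (a, y))%:C.
  have := ext_split hM1 hT1 hM2 hT2 eq _ avg a y.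
  rewrite uu (_ : 2^-1 + 2^-1 = 1); last by field.
  move=> /(_ erefl)/=; rewrite (hu (Bh1 (y j) (a j) \o rest_op j a y))/=.
  by apply: mulfI; rewrite invr_eq0 pnatr_eq0.
have XE v : X v = \sum_(a : bits n | a j == b) X (rest_op j a (cbits (x j)) v).
  rewrite -[LHS]/(\sum_(a : bits n | a j == b) T a (cbits (x j)) v).
  by apply: eq_bigr => a /eqP ab; rewrite (T_factor' a _ j) ffunE ab.
have XX : ip (X (X psi)) psi = ip (X psi) psi.
  rewrite [in LHS](XE psi) linear_sum inner_suml.
  transitivity (\sum_(a : bits n | a j == b) (q (a, cbits (x j)))%:C).
    by apply: eq_bigr => a /eqP ab; rewrite -key ffunE /Bh1 eqxx ab eqxx.
  rewrite [in RHS](XE psi) inner_suml; apply: eq_bigr => a /eqP ab.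
  by rewrite hq (T_factor' a _ j) ffunE ab.
have pX : positive_op X := local_op_positive pE lX.
have pXc : positive_op Xc := local_op_positive pF lXc.
(* X (1 - X) is positive and has mean zero in psi, so it kills psi. *)
have XXc0 : X (Xc psi) = 0.
  apply: (positive_ker (complementary_positive pX pXc XXc)) => /=.
  have -> : X (Xc psi) = X psi - X (X psi).
    by apply/eqP; rewrite eq_sym subr_eq addrC -linearD XXc.
  by rewrite innerBl XX subrr.
by rewrite -/X -{2}(XXc psi) linearD XXc0 addr0.
Qed.
End idempotent.


Section swap.
Variable j : 'I_n.
Local Notation G xi b := (effect_op j (cbits xi) b).
(** [u] and [v] are L psi and L' psi for outcome 0. [Gu] is party [j] with inputs exchanged and
    outputs flipped, [Gv] with inputs exchanged. *)
Let u : K := G 0 0 psi - G 1 0 psi.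
Let v : K := psi - G 0 0 psi - G 1 0 psi.
Let Bu xi c : {linear H j -> H j} := M j (xi + 1) (c + 1).
Let Gu xi c : {linear K -> K} := G (xi + 1) (c + 1).
Let Gv xi c : {linear K -> K} := G (xi + 1) c.

Let G_positive xi c : positive_op (G xi c).
Proof. exact: (effect_op_positive hM hT). Qed.

Let G_idem xi c : G xi c (G xi c psi) = G xi c psi.
Proof. by have := effect_op_idem j (cbits xi) c; rewrite ffunE. Qed.

Let G1E xi : G xi 1 psi = psi - G xi 0 psi.
Proof. by apply/eqP; rewrite eq_sym subr_eq addrC (effect_op_sum hM hT). Qed.

Let povm_Bu xi : povm (Bu xi).
Proof.
split=> [c|c|w]; [exact: (M_bounded hM)|exact: (M_positive hM)|].
by rewrite (sumZ2' _ 1) /Bu Z2_add11 add0r (M_sum hM).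
Qed.

Let local_G xi c : local_op (M j xi c) (G xi c).
Proof. by have := effect_op_local hM hT j (cbits xi) c; rewrite ffunE. Qed.

(** Another input or outcome changes L psi and L' psi at most by a sign, which cancels in the
    quadratic forms; one pair [u], [v] thus serves all [(a, y)]. *)
Lemma swap_split a y : (q (a, y))%:C =
  ip (Gu (y j) (a j) (rest_op j a y u)) u + ip (Gv (y j) (a j) (rest_op j a y v)) v.
Proof.
rewrite hq (T_factor' a y j).
have XN xi c w : G xi c (rest_op j a y w) = rest_op j a y (G xi c w) :=
  effect_op_rest hM hT j a y (cbits xi) c w.
rewrite -(@swap_identity _ _ (G (y j) (a j)) (G (y j + 1) (a j))
  (G (y j + 1) (a j + 1)) (rest_op j a y) psi) //.
- have neg (A : {linear K -> K}) w : ip (A (- w)) (- w) = ip (A w) w.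
    by rewrite linearN innerNl innerNr opprK.
  have e0 : (0 : 'Z_2) + 1 = 1 by rewrite add0r.
  have hL' : psi - G (y j) (a j) psi - G (y j + 1) (a j) psi = v \/
      psi - G (y j) (a j) psi - G (y j + 1) (a j) psi = - v.
    have [->|->] := Z2P (y j); have [->|->] := Z2P (a j); rewrite ?e0 ?Z2_add11 ?G1E /v.
    + by left.
    + by right; rewrite subV.
    + by left; rewrite addrAC.
    + by right; rewrite subV [in LHS]addrAC.
  have [L|L] : G (y j) (a j) psi - G (y j + 1) (a j) psi = u \/
      G (y j) (a j) psi - G (y j + 1) (a j) psi = - u.
    have [->|->] := Z2P (y j); have [->|->] := Z2P (a j); rewrite ?e0 ?Z2_add11 ?G1E /u.
    + by left.
    + by right; rewrite subBB opprB.
    + by right; rewrite opprB.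
    + by left; rewrite subBB.
  + case: hL' => L'; rewrite L L' //.
    by rewrite (neg (Gv _ _ \o rest_op j a y)).
  + case: hL' => L'; rewrite L L' (neg (Gu _ _ \o rest_op j a y)) //.
    by rewrite (neg (Gv _ _ \o rest_op j a y)).
- exact: G_positive.
- exact: G_positive.
- exact: (rest_op_positive hM hT).
- by move=> w; exact: effect_op_sum'.
- exact: XN.
- exact: XN.
- exact: G_idem.
- exact: G_idem.
Qed.

Lemma rest_op_psi a y : ip (rest_op j a y psi) psi = (\sum_b q (upd a j b, y))%:C.
Proof.
rewrite rmorph_sum/= -[rest_op j a y psi]/(\sum_b T (upd a j b) y psi) inner_suml.
by apply: eq_bigr => b _; rewrite hq.
Qed.

(** [ext_split] gives this for each outcome of party [j]; summing over that outcome removes the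
    effect of [j]. *)
Lemma rest_op_u a y : ip (rest_op j a y u) u = ip u u * (\sum_b q (upd a j b, y))%:C.
Proof.
have [hM1 hT1] := replace_party hM hT povm_Bu (fun xi c => local_G (xi + 1) (c + 1)).
have [hM2 hT2] := replace_party hM hT (fun xi => hM j (xi + 1))
  (fun xi c => local_G (xi + 1) c).
(* The sum of the swap identities for the outcomes 0 and 1, with the identity as [N]. *)
have uv : ip u u + ip v v = 1.
  have := @swap_identity _ _ (G 0 0) (G 1 0) (G 1 1) idfun psi (G_positive _ _)
    (G_positive _ _) idfun_positive (effect_op_sum hM hT j _) (fun=> erefl) (fun=> erefl)
    (G_idem _ _) (G_idem _ _).
  have := @swap_identity _ _ (G 0 1) (G 1 1) (G 1 0) idfun psi (G_positive _ _)
    (G_positive _ _) idfun_positive _ (fun=> erefl) (fun=> erefl)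
    (G_idem _ _) (G_idem _ _).
  have -> : G 0 1 psi - G 1 1 psi = - u.
    by rewrite !G1E subBB opprB.
  have -> : psi - G 0 1 psi - G 1 1 psi = - v.
    by rewrite !G1E subV.
  have s w : G 1 1 w + G 1 0 w = w by rewrite addrC (effect_op_sum hM hT).
  move=> /(_ s)/=; rewrite -/u -/v.
  rewrite !linearN/= !innerNl !innerNr !opprK => e1 e2.
    have E w : ip w w = ip (G 1 0 w) w + ip (G 1 1 w) w.
    by rewrite -innerDl (effect_op_sum hM hT).
  rewrite (E u) (E v).
  have : ip (G 1 1 u) u + ip (G 1 0 v) v + (ip (G 1 0 u) u + ip (G 1 1 v) v) = 1.
    by rewrite e1 e2 /= -innerDl (effect_op_sum hM hT).
  by move=> <-; ring.
have := ext_split hM1 hT1 hM2 hT2 eq uv swap_split.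
move=> h; have N b : rest_op j (upd a j b) y u = rest_op j a y u.
  by apply: (rest_op_eq hM hT) => i ij; rewrite ffunE (negbTE ij).
rewrite rmorph_sum mulr_sumr.
under eq_bigr do rewrite /= -h /= ffunE eqxx N.
rewrite sumZ2 /Gu add0r Z2_add11 [RHS]addrC -innerDl.
by rewrite (effect_op_sum hM hT).
Qed.

(* Cauchy-Schwarz for the positive form N = rest_op j a y, between u and psi:
   extremality makes <N u, u> a multiple of <N psi, psi>, so that the bound
   gains a factor |u|^2, of the order of the deviation from p(0|x) = 1. *)
Lemma flip_estimate a y : (q (a, y) - q (a, upd y j (y j + 1))) ^+ 2 <=
  sqn u * (\sum_b q (upd a j b, y)) ^+ 2.
Proof.
set y' := upd y j (y j + 1); set S := \sum_b q (upd a j b, y); set N := rest_op j a y.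
have y'j : y' j = y j + 1 by rewrite ffunE eqxx.
have NN w : rest_op j a y' w = N w.
  by apply: (rest_op_eq hM hT) => i ij; rewrite ffunE (negbTE ij).
have XN xi c w : G xi c (N w) = N (G xi c w) :=
    effect_op_rest hM hT j a y (cbits xi) c w.
have d : `|(q (a, y) - q (a, y'))%:C| = `|ip (N u) psi|.
  rewrite rmorphB/= !hq !(T_factor' a _ j) y'j NN !XN -innerBl /N -linearB -/N.
  have e0 : (0 : 'Z_2) + 1 = 1 by rewrite add0r.
  have neg w : `|ip (N (- w)) psi| = `|ip (N w) psi| by rewrite /N linearN innerNl normrN.
  have [->|->] := Z2P (y j); have [->|->] := Z2P (a j); rewrite ?e0 ?Z2_add11 ?G1E ?subBB //.
  - by rewrite -neg opprB.
  - by rewrite -neg opprB.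
rewrite -lecR.
have -> : (sqn u * S ^+ 2)%:C = ip u u * (S%:C * S%:C) by rewrite rmorphM/= sqnE rmorphM.
have -> : ((q (a, y) - q (a, y')) ^+ 2)%:C = `|(q (a, y) - q (a, y'))%:C| ^+ 2.
  rewrite real_normK ?rmorphXn//; apply/complex_realP; by eexists.
rewrite d; apply: le_trans (positive_CS (rest_op_positive hM hT _ _ _) _ _) _.
by rewrite rest_op_u rest_op_psi -mulrA.
Qed.

(** Outcome 1 is the rare one near the all-zero point. Written with its effects, [u] is a difference
    of two vectors whose squared norms are, by idempotence, probabilities of outcome 1; then |x -
    y|^2 <= 2 |x|^2 + 2 |y|^2. *)
Lemma sqn_u : sqn u <= 2 * \sum_(a : bits n | a j == 1) q (a, cbits 0) +
  2 * \sum_(a : bits n | a j == 1) q (a, cbits 1).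
Proof.
have -> : u = G 1 1 psi - G 0 1 psi by rewrite !G1E subBB.
have s xi : \sum_(a : bits n | a j == 1) q (a, cbits xi) = sqn (G xi 1 psi).
  apply: complexI; rewrite sqnE -(positive_herm (G_positive xi 1))/= G_idem.
  rewrite -[G xi 1 psi]/(\sum_(a : bits n | a j == 1) T a (cbits xi) psi) inner_suml rmorph_sum/=.
  by apply: eq_bigr => a _; rewrite hq.
rewrite !s parallelogram.
have := sqn_ge0 (2^-1 *: (G 1 1 psi + G 0 1 psi)); lra.
Qed.

End swap.

End estimate.

Section defect.
Context {R : realType} {n : nat}.
Implicit Types (q : corr R n) (a x : bits n) (j : 'I_n).

Definition defect q : R := \sum_x (1 - q (@cbits n 0, x)).

(** An event that misses the outcome 0 has probability at most 1 - q(0|x), one of the nonnegative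
    summands of the defect. *)
Lemma sum_le_defect q x (P : pred (bits n)) : quantum_set R n q ->
  ~~ P (@cbits n 0) -> \sum_(a | P a) q (a, x) <= defect q.
Proof.
move=> Qq P0; apply: (@le_trans _ _ (1 - q (@cbits n 0, x))).
  rewrite -(quantum_sum1 x Qq) [in leRHS](bigD1 (@cbits n 0))//= [leRHS]addrC addKr.
  rewrite [leRHS](bigID P)/= [X in _ <= X + _](eq_bigl P); last first.
    move=> a; case: eqVneq => [->|]; rewrite ?andbT//=.
    by rewrite (negbTE P0).
  by rewrite lerDl sumr_ge0// => a _; exact: quantum_ge0.
rewrite /defect (bigD1 x)//= lerDl sumr_ge0// => y _; rewrite subr_ge0.
rewrite -(quantum_sum1 y Qq) (bigD1 (@cbits n 0))//= lerDl sumr_ge0// => a _.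
exact: quantum_ge0.
Qed.

(** The marginal S over the bit of [j] is at most the defect because the nonzero bit [a i] survives
    the summation. The constant 4 collects the two terms of [sqn_u]. *)
Lemma ext_flip q a x j : Ext (quantum_set R n) q ->
  (exists2 i, i != j & a i != 0) ->
  (q (a, x) - q (a, upd x j (x j + 1))) ^+ 2 <= 4 * defect q ^+ 3.
Proof.
move=> eq [i ij ai]; have Qq := eq.1.
have [H [K [M [T [psi [hM hT psi1 hq]]]]]] := ext_pure eq.
apply: le_trans (flip_estimate hM hT psi1 hq eq j a x) _.
set S := \sum_b _; set w := sqn _.
have cj b (c : 'Z_2) : (@cbits n b j == c) = (b == c) by rewrite ffunE.
have S0 : 0 <= S by rewrite sumr_ge0// => b _; exact: quantum_ge0.
have Sd : S <= defect q.
  apply: le_trans (sum_le_defect x (P := [pred c : bits n | c i != 0]) Qq _); last first.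
    by rewrite /= ffunE eqxx.
  rewrite /S sumZ2 (bigD1 (upd a j 0))/=; last by rewrite ffunE (negbTE ij).
  rewrite lerD2l (bigD1 (upd a j 1))/=; last first.
    rewrite ffunE (negbTE ij) ai/=; apply/eqP => /ffunP/(_ j).
    by rewrite !ffunE eqxx.
  by rewrite lerDl sumr_ge0// => c _; exact: quantum_ge0.
have wd : w <= 4 * defect q.
  apply: le_trans (sqn_u hM hT psi1 hq eq j) _.
  have h b := sum_le_defect (@cbits n b) (P := [pred c : bits n | c j == 1]) Qq.
  have h0 := h 0; have h1 := h 1.
  rewrite /= !cj /= in h0 h1.
  by have := h0 isT; have := h1 isT; move=> k1 k0; lra.
have d0 : 0 <= defect q := le_trans S0 Sd.
rewrite [defect q ^+ 3]exprS mulrA; apply: ler_pM => //; first exact: sqn_ge0.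
  by rewrite exprn_ge0.
by rewrite ler_pXn2r ?nnegrE.
Qed.
End defect.

(** * Local deterministic mixtures *)

Section diag.
Context {R : realType} {J : finType}.
Implicit Types (d : J -> R[i]) (u v : l2H R J).

Definition diag d : l2H R J -> l2H R J := fun v => [ffun j => d j * v j].
Lemma diag_is_linear d : linear (diag d).
Proof.
move=> c u v; apply/ffunP => j; rewrite !ffunE /GRing.scale/=.
by rewrite mulrDr mulrCA.
Qed.
HB.instance Definition _ d := GRing.isLinear.Build _ _ _ _ (diag d) (diag_is_linear d).

Lemma ip_l2 u v : ip u v = \sum_j u j * (v j)^*.
Proof. by []. Qed.

Lemma diag_bounded d : bounded_op (diag d).
Proof.
apply: (@le_bounded _ _ _ (\sum_j `|d j|)) => [|v]; first by rewrite sumr_ge0.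
apply: le_trans (l2norm_le _) _; rewrite mulr_suml; apply: ler_sum => j _.
by rewrite ffunE normrM ler_wpM2l// l2coord_le.
Qed.

Lemma diag_positive d : (forall j, 0 <= d j) -> positive_op (diag d).
Proof.
move=> d0; apply: positiveI => v; rewrite ip_l2 sumr_ge0// => j _.
by rewrite ffunE -mulrA mulr_ge0// mul_conjC_ge0.
Qed.
End diag.

Section classical.
Context {R : realType} {n : nat} {J : finType}.
Implicit Types (x y : 'I_n -> l2H R J).
Local Notation N := {ffun 'I_n -> J}.

Definition l2tens x : l2H R N := [ffun k : N => \prod_(i < n) x i (k i)].

Lemma l2tens_linear x (i : 'I_n) (c : R[i]) (u v : l2H R J) :
  l2tens (dfwith x i (c *: u + v)) = c *: l2tens (dfwith x i u) + l2tens (dfwith x i v).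
Proof.
apply/ffunP => k; rewrite !ffunE /GRing.scale/=.
have h w : \prod_(l < n) (dfwith x i w) l (k l) =
    w (k i) * \prod_(l < n | l != i) x l (k l).
  rewrite (bigD1 i)//= dfwithin; congr (_ * _); apply: eq_bigr => l li.
  by rewrite dfwithout// eq_sym.
by rewrite !h !ffunE /GRing.scale/= mulrDl mulrA.
Qed.

Lemma l2tens_inner x y :
  inner (l2tens x) (l2tens y) = \prod_(i < n) inner (x i) (y i).
Proof.
transitivity (\prod_(i < n) \sum_j x i j * (y i j)^*); last by [].
rewrite bigA_distr_bigA -[LHS]/(ip (l2tens x) (l2tens y)) ip_l2; apply: eq_bigr => k _.
by rewrite !ffunE rmorph_prod -big_split.
Qed.

Lemma l2tens_total : closure (lin_span (range l2tens)) = setT.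
Proof.
apply/seteqP; split=> // v _; apply: subset_closure.
pose b (k : N) : 'I_n -> l2H R J := fun i => [ffun j => (j == k i)%:R].
have -> : v = \sum_(k : N) v k *: l2tens (b k).
  apply/ffunP => k; rewrite sum_ffunE (bigD1 k)//= big1 => [|l lk].
    rewrite !ffunE addr0 /GRing.scale/= big1 ?mulr1// => i _.
    by rewrite ffunE eqxx.
  rewrite !ffunE /GRing.scale/=; apply/eqP; rewrite mulf_eq0; apply/orP; right.
  have [i ki] : exists i, k i != l i.
    apply/existsP; rewrite -negb_forall; apply: contra lk => /forallP h.
    by apply/eqP/ffunP => i; apply/esym/eqP.
  by rewrite (bigD1 i)//= ffunE (negbTE ki) mul0r.
elim/big_ind : _ => [||k _]; [exact: lin_span0|exact: lin_spanD|].
by apply/lin_spanZ/lin_span_sub; exists (b k).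
Qed.

Definition l2tensor : tensorProduct (fun _ : 'I_n => l2H R J) :=
  TensorProduct l2tens_linear l2tens_inner l2tens_total.

(** Shared randomness as entanglement: psi is the sum of the sqrt(lam j) e_j (x) ... (x) e_j, and
    every party reads j in the common basis. The party [i0] provides the index of a diagonal
    entry. *)
Lemma classical_quantum (i0 : 'I_n) (lam : J -> R) (g : J -> 'I_n -> 'Z_2 -> 'Z_2)
    (p : corr R n) :
  (forall j, 0 <= lam j) -> \sum_j lam j = 1 ->
  (forall s, p s = \sum_j lam j * local_det R (g j) s) -> quantum_set R n p.
Proof.
move=> lam0 lam1 hp.
pose dM i xi (a : 'Z_2) (j : J) : R[i] := (a == g j i xi)%:R.
pose M : measurement (fun _ : 'I_n => l2H R J) := fun i xi a => diag (dM i xi a).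
pose dT (a x : bits n) (k : N) : R[i] := \prod_(i < n) dM i (x i) (a i) (k i).
pose T (a x : bits n) : {linear l2tensor -> l2tensor} := diag (dT a x).
have hM : povms M.
  move=> i xi; split=> [a|a|v]; first exact: diag_bounded.
    by apply: diag_positive => j; rewrite /dM ler0n.
  rewrite sumZ2; apply/ffunP => j; rewrite !ffunE -mulrDl.
  by rewrite /dM; have [->|->] := Z2P (g j i xi); rewrite /= ?addr0 ?add0r mul1r.
have hT : tensor_ops M T.
  move=> a x; split; first exact: diag_bounded.
  move=> y; apply/ffunP => k; rewrite !ffunE /dT -big_split/=.
  by apply: eq_bigr => i _; rewrite ffunE.
pose c (j : J) : N := [ffun=> j].
pose psi : l2tensor := [ffun k : N => if k == c (k i0) then sqrtC (lam (k i0))%:C else 0].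
have sumpsi (t : N -> R[i]) : \sum_k t k * psi k * (psi k)^* = \sum_j (lam j)%:C * t (c j).
  rewrite (bigID (fun k : N => k == c (k i0)))/= [X in _ + X]big1 ?addr0; last first.
    by move=> k /negbTE kc; rewrite ffunE kc mulr0 mul0r.
  rewrite (reindex_onto c (fun k : N => k i0))/=; last by move=> k /eqP {2}->.
  rewrite (eq_bigl xpredT) => [|j]; last by rewrite !ffunE !eqxx.
  apply: eq_bigr => j _; rewrite ffunE ffunE eqxx -mulrA -normCK.
  have -> : `|sqrtC (lam j)%:C| = sqrtC (lam j)%:C.
    by rewrite ger0_norm// sqrtC_ge0 lecR.
  by rewrite sqrtCK mulrC.
apply: (@pure_quantum _ _ _ _ _ _ hM hT psi) => [|a x].
  rewrite ip_l2; under eq_bigr do rewrite -[X in X * _]mul1r.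
  rewrite sumpsi; under eq_bigr do rewrite mulr1.
  by rewrite -rmorph_sum lam1.
rewrite ip_l2; under eq_bigr do rewrite ffunE.
rewrite sumpsi hp rmorph_sum; apply: eq_bigr => j _.
rewrite rmorphM ffunE/= /dT rmorph_prod/=; congr (_ * _); apply: eq_bigr => i _.
by rewrite /dM ffunE rmorph_nat.
Qed.
End classical.

(** * Extreme points in a plane *)

Section plane.
Context {R : realType} {E : lmodType R}.
Implicit Types (u v w d e p q : E).

Definition linear_form (f : E -> R) := forall (a : R) u v, f (a *: u + v) = a * f u + f v.

Lemma linear_form0 f : linear_form f -> f 0 = 0.
Proof. by move=> /(_ (-1) 0 0); rewrite scaler0 addr0 mulN1r addNr. Qed.

Lemma linear_formZ f a u : linear_form f -> f (a *: u) = a * f u.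
Proof. by move=> h; rewrite -[a *: u]addr0 h linear_form0// addr0. Qed.

Lemma linear_form2 f a b u v : linear_form f -> f (a *: u + b *: v) = a * f u + b * f v.
Proof. by move=> h; rewrite h linear_formZ. Qed.

Lemma regroup (A X Y P T : E) : A + (X + Y) + (P - A + (T - X)) - P = T + Y.
Proof.
by rewrite addrACA [A + (P - A)]addrC subrK [LHS]addrC addKr [LHS]addrC addrA subrK.
Qed.

Lemma small_sqr (x C : R) :
  (forall r, 0 < r -> exists2 t, 0 < t < r & x ^+ 2 <= C * t) -> x = 0.
Proof.
move=> h; apply/eqP; rewrite -sqrf_eq0; apply: contraT => x0.
have xp : 0 < x ^+ 2 by rewrite lt_def x0 sqr_ge0.
have cp : 0 < `|C| + 1 by rewrite ltr_wpDl.
have [t /andP[t0 tr] xt] := h _ (divr_gt0 xp cp).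
move: tr; rewrite ltr_pdivlMr// => tr.
have : C * t <= `|C| * t by rewrite ler_wpM2r ?ler_norm// ltW.
move: xt tr; nra.
Qed.

(** The planar argument, detached from quantum theory: [eps] measures the distance to [p0], the
    [l m] are the flip and normalisation forms, the [o k] the probabilities of outcomes other than
    0. The last hypothesis says that [Q] contains, near [p0], the cone they cut out. *)
Lemma plane_extreme_isolated (Q : set E) (p0 : E) (eps : E -> R) (I J : Type)
    (l : I -> E -> R) (o : J -> E -> R) (C : R) (u v : E) :
  linear_form eps -> (forall m, linear_form (l m)) -> (forall k, linear_form (o k)) ->
  Q p0 ->
  (forall q, Q q -> 0 <= eps (q - p0)) ->
  (forall q, Q q -> eps (q - p0) = 0 -> q = p0) ->
  (forall q k, Q q -> 0 <= o k (q - p0)) ->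
  (forall q m, Ext Q q -> l m (q - p0) ^+ 2 <= C * eps (q - p0) ^+ 3) ->
  (forall d, (forall m, l m d = 0) -> (forall k, 0 <= o k d) -> eps d <= 1 ->
    Q (p0 + d)) ->
  exists2 r, 0 < r & forall q, Ext Q q -> (exists s t, q - p0 = s *: u + t *: v) ->
    eps (q - p0) < r -> q = p0.
Proof.
move=> leps ll lo Q0 eps_ge0 eps_eq0 o_ge0 l_le Qcone.
apply: contrapT => hr.
have {hr} small r : 0 < r -> exists q, [/\ Ext Q q,
    exists s t, q - p0 = s *: u + t *: v, 0 < eps (q - p0) & eps (q - p0) < r].
  move=> r0; apply: contrapT => hq; apply: hr; exists r => // q eq hs er.
  apply: eps_eq0; first exact: eq.1.
  apply/eqP; rewrite eq_le (eps_ge0 _ eq.1) andbT leNgt; apply/negP => e0.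
  by apply: hq; exists q.
(* Such a q would be the midpoint of p0 and p0 + 2 (q - p0); the bound 1/2 keeps the latter within
   eps <= 1. *)
have not_cone q : Ext Q q -> 0 < eps (q - p0) -> eps (q - p0) <= 2^-1 ->
    ~ (forall m, l m (q - p0) = 0).
  move=> [Qq eq] e0 e1 hl.
  have Qr : Q (p0 + 2 *: (q - p0)).
    apply: Qcone => [m|k|]; rewrite linear_formZ//.
    - by rewrite hl mulr0.
    - by rewrite mulr_ge0// o_ge0.
    - lra.
  have [||qp _] := eq p0 _ 2^-1 Q0 Qr.
  - by apply/andP; split; lra.
  - have -> : 1 - 2^-1 = 2^-1 :> R by lra.
    rewrite scalerDr scalerA mulVf ?pnatr_eq0// scale1r addrA -scalerDl.
    have -> : 2^-1 + 2^-1 = 1 :> R by lra.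
    by rewrite scale1r addrC subrK.
  by move: e0; rewrite -qp subrr linear_form0// ltxx.
(* Coordinates adapted to eps: a point of the plane is p0 + eps d + b e, so only b remains to be
   controlled. *)
have [d [e [epsd epse span]]] : exists d e, [/\ eps d = 1, eps e = 0 &
    forall w, (exists s t, w = s *: u + t *: v) -> exists b, w = eps w *: d + b *: e].
  have [u0|u0] := eqVneq (eps u) 0; last first.
    exists ((eps u)^-1 *: u), (v - (eps v / eps u) *: u); split.
    - by rewrite linear_formZ// mulVf.
    - by rewrite addrC -scaleNr leps; field.
    move=> w [s [t ->]]; exists t; rewrite linear_form2// scalerBr !scalerA.
    rewrite addrCA -scalerBl addrC; congr (_ *: _ + _).
    by field.
  have [v0|v0] := eqVneq (eps v) 0.
    have [q [_ [s [t ->]]]] := small 1 ltr01.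
    by rewrite linear_form2// u0 v0 !mulr0 addr0 ltxx.
  exists ((eps v)^-1 *: v), u; split=> //; first by rewrite linear_formZ// mulVf.
  move=> w [s [t ->]]; exists s; rewrite linear_form2// u0 mulr0 add0r scalerA.
  by rewrite mulfK// addrC.
(* If no form sees [e], the estimate makes every form vanish on [d] as well, and the extreme points
   near [p0] lie in the cone. *)
have [hle|[m0 lm0]] : (forall m, l m e = 0) \/ exists m, l m e != 0.
  by have [|/existsNP[m /eqP]] := pselect (forall m, l m e = 0); [left|right; exists m].
  have ld m : l m d = 0.
    apply: (@small_sqr _ C) => r r0; have [q [eq hs e0 er]] := small r r0.
    exists (eps (q - p0)); first by rewrite e0.
    have [b qE] := span _ hs; have := l_le q m eq.
    rewrite [X in l m X]qE linear_form2// hle mulr0 addr0.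
    move: (eps (q - p0)) e0 => t t0 h.
    have t2 : 0 < t ^+ 2 by rewrite exprn_gt0.
    rewrite -(ler_pM2l t2) -exprMn; apply: le_trans h _.
    by rewrite le_eqVlt; apply/orP; left; apply/eqP; ring.
  have h2 : 0 < 2^-1 :> R by lra.
  have [q [eq hs e0 er]] := small _ h2.
  apply: (not_cone q eq e0 (ltW er)) => m; have [b ->] := span _ hs.
  by rewrite linear_form2// ld hle !mulr0 addr0.
(* Tilting [d] along [e] until [l m0] vanishes on it lets [l m0] read off b. Then b^2 = O(eps^3),
   and [d] is the limit direction of the extreme points. *)
wlog lmd : d epsd span / l m0 d = 0.
  move=> H; apply: (H (d - (l m0 d / l m0 e) *: e)).
  - by rewrite addrC -scaleNr leps epsd epse mulr0 add0r.
  - move=> w /span[b wE]; exists (b + eps w * (l m0 d / l m0 e)).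
    by rewrite {1}wE scalerBr scalerDl scalerA addrACA addNr addr0.
  - by rewrite addrC -scaleNr ll; field.
pose D := C / l m0 e ^+ 2.
have beta q b : Ext Q q -> q - p0 = eps (q - p0) *: d + b *: e ->
    b ^+ 2 <= D * eps (q - p0) ^+ 3.
  move=> eq qE; have := l_le q m0 eq.
  rewrite [X in l m0 X]qE linear_form2// lmd mulr0 add0r exprMn => h.
  have -> : D * eps (q - p0) ^+ 3 = C * eps (q - p0) ^+ 3 / l m0 e ^+ 2.
    by rewrite /D mulrAC.
  by rewrite ler_pdivlMr// lt_def sqr_ge0 sqrf_eq0 lm0.
have ld m : l m d = 0.
  apply: (@small_sqr _ (2 * C + 2 * D * l m e ^+ 2)) => r r0.
  have [q [eq hs e0 er]] := small r r0.
  exists (eps (q - p0)); first by rewrite e0.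
  have [b qE] := span _ hs; have := l_le q m eq; have := beta q b eq qE.
  rewrite [X in l m X]qE linear_form2//.
  move: (eps (q - p0)) e0 => t t0 h1 h2.
  have t2 : 0 < t ^+ 2 by rewrite exprn_gt0.
  rewrite -(ler_pM2l t2).
  have h3 : b ^+ 2 * l m e ^+ 2 <= D * t ^+ 3 * l m e ^+ 2 by rewrite ler_wpM2r// sqr_ge0.
  have := sqr_ge0 (t * l m d + b * l m e + b * l m e).
  move: h2 h3; move: (l m d) (l m e) => x y; nra.
(* If o k d were negative, o k (q - p0) >= 0 would force |eps o k d| <= |b o k e|, which is of order
   eps^(3/2). *)
have od k : 0 <= o k d.
  rewrite leNgt; apply/negP => od.
  have : o k d = 0; last by move: od => /[swap] ->; rewrite ltxx.
  apply: (@small_sqr _ (D * o k e ^+ 2)) => r r0.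
  have [q [eq hs e0 er]] := small r r0.
  exists (eps (q - p0)); first by rewrite e0.
  have [b qE] := span _ hs; have := o_ge0 q k eq.1; have := beta q b eq qE.
  rewrite [X in o k X]qE linear_form2//.
  move: (eps (q - p0)) e0 => t t0 h1 h2.
  have t2 : 0 < t ^+ 2 by rewrite exprn_gt0.
  rewrite -(ler_pM2l t2).
  have h3 : b ^+ 2 * o k e ^+ 2 <= D * t ^+ 3 * o k e ^+ 2 by rewrite ler_wpM2r// sqr_ge0.
  have h4 : (t * o k d) ^+ 2 <= (b * o k e) ^+ 2.
    have h5 : 0 < - (t * o k d) by rewrite -mulrN mulr_gt0// oppr_gt0.
    by rewrite -[leLHS]sqrrN ler_pXn2r ?nnegrE//; lra.
  rewrite -exprMn; apply: le_trans h4 _; rewrite exprMn; apply: le_trans h3 _.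
  by rewrite le_eqVlt; apply/orP; left; apply/eqP; ring.
have Qd c : 0 <= c <= 1 -> Q (p0 + c *: d).
  move=> /andP[c0 c1]; apply: Qcone => [m|k|]; rewrite linear_formZ//.
  - by rewrite ld mulr0.
  - by rewrite mulr_ge0.
  - by rewrite epsd mulr1.
(* Two extreme points on the same side of the ray spanned by d exclude each
   other: the closer one is a mixture of the other and a point of the ray. *)
have pair q1 b1 : Ext Q q1 -> q1 - p0 = eps (q1 - p0) *: d + b1 *: e ->
    0 < eps (q1 - p0) -> b1 != 0 -> exists2 r, 0 < r &
    forall q2 b2, Ext Q q2 -> q2 - p0 = eps (q2 - p0) *: d + b2 *: e ->
    0 < eps (q2 - p0) -> eps (q2 - p0) < r -> ~ 0 < b2 / b1.
  move=> eq1 q1E t10 b10; set t1 := eps (q1 - p0) in q1E t10 *.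
  have D0 : 0 <= D.
    have := beta q1 b1 eq1 q1E; rewrite -/t1 => h.
    have : 0 <= D * t1 ^+ 3 by apply: le_trans h; rewrite sqr_ge0.
    by rewrite pmulr_lge0// exprn_gt0.
  have b1p : 0 < b1 ^+ 2 by rewrite lt_def sqrf_eq0 b10 sqr_ge0.
  have dp : 0 < D * t1 ^+ 2 + 1 by rewrite ltr_wpDl// mulr_ge0// sqr_ge0.
  (* The last bound gives b t1 <= t2, so the point of the ray has a nonnegative coefficient. With t2
     < t1 / 2 this yields b <= 1/2, and q1 differs from q2. Then t2 < 1/2 keeps the coefficient
     below 1. *)
  exists (Num.min 2^-1 (Num.min (t1 / 2) (b1 ^+ 2 / (D * t1 ^+ 2 + 1)))).
    by rewrite !lt_min invr_gt0 !divr_gt0// ltr0n.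
  move=> q2 b2 eq2 q2E t20; set t2 := eps (q2 - p0) in q2E t20 *.
  rewrite !lt_min => /and3P[t2h t21 t2b] b0.
  (* The coordinate along [e] dictates the weight b of q1 in the mixture. *)
  set b := b2 / b1 in b0.
  have bt : b * t1 <= t2.
    have nbt : b * t1 \is Num.nneg by rewrite nnegrE mulr_ge0//; exact: ltW.
    have nt2 : t2 \is Num.nneg by rewrite nnegrE ltW.
    rewrite -(@ler_pXn2r _ 2 isT _ _ nbt nt2).
    have := beta q2 b2 eq2 q2E; rewrite -/t2 => h.
    have -> : (b * t1) ^+ 2 = b2 ^+ 2 * t1 ^+ 2 / b1 ^+ 2 by rewrite /b; field.
    rewrite ler_pdivrMr//.
    move: t2b; rewrite ltr_pdivlMr// => t2b.
    apply: (@le_trans _ _ (D * t2 ^+ 3 * t1 ^+ 2)); first by rewrite ler_wpM2r// sqr_ge0.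
    have -> : D * t2 ^+ 3 * t1 ^+ 2 = t2 ^+ 2 * (t2 * (D * t1 ^+ 2)) by ring.
    rewrite ler_wpM2l ?sqr_ge0//; apply: le_trans (ltW t2b).
    by rewrite mulrDr mulr1 lerDl ltW.
  have bh : b <= 2^-1 by nra.
  have Qr : Q (p0 + ((t2 - b * t1) / (1 - b)) *: d).
    apply: Qd; apply/andP; split; first by rewrite divr_ge0; lra.
    by rewrite ler_pdivrMr; nra.
  have [||q12 _] := eq2.2 q1 _ b eq1.1 Qr.
  - by rewrite b0; lra.
  - rewrite scalerDr scalerA mulrC divfK; last by apply/eqP; lra.
    apply: (addIr (- p0)); rewrite q2E.
    have -> : q1 = p0 + (t1 *: d + b1 *: e) by rewrite -q1E addrC subrK.
    have bb : b * b1 = b2 by rewrite /b divfK.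
    rewrite scalerDr scalerBl scale1r scalerDr !scalerA scalerBl bb.
    exact: esym (regroup _ _ _ _ _).
  by move: t21; rewrite /t2 -q12 -/t1; lra.
have next r : 0 < r -> exists q b, [/\ Ext Q q, q - p0 = eps (q - p0) *: d + b *: e,
    0 < eps (q - p0), eps (q - p0) < r & b != 0].
  move=> r0; have [|q [eq hs e0]] := small (Num.min r 2^-1).
    by rewrite lt_min r0 invr_gt0 ltr0n.
  rewrite lt_min => /andP[er eh]; have [b qE] := span _ hs.
  exists q, b; split=> //; apply/eqP => b0.
  apply: (not_cone q eq e0 (ltW eh)) => m.
  by rewrite qE b0 scale0r addr0 linear_formZ// ld mulr0.
(* Three nonzero numbers b1, b2, b3 cannot have pairwise opposite signs. *)
have [q1 [b1 [eq1 q1E e1 _ n1]]] := next 1 ltr01.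
have [r1 r10 h1] := pair q1 b1 eq1 q1E e1 n1.
have [q2 [b2 [eq2 q2E e2 l2 n2]]] := next r1 r10.
have [r2 r20 h2] := pair q2 b2 eq2 q2E e2 n2.
have [|q3 [b3 [eq3 q3E e3]]] := next (Num.min r1 r2); first by rewrite lt_min r10.
rewrite lt_min => /andP[l31 l32] n3.
have k21 : b2 / b1 <= 0 by rewrite leNgt; apply/negP; apply: h1 eq2 q2E e2 l2.
have k31 : b3 / b1 <= 0 by rewrite leNgt; apply/negP; apply: h1 eq3 q3E e3 l31.
have k32 : b3 / b2 <= 0 by rewrite leNgt; apply/negP; apply: h2 eq3 q3E e3 l32.
have : 0 <= (b2 / b1) * (b3 / b1) by rewrite mulr_le0.
have -> : (b2 / b1) * (b3 / b1) = (b3 / b2) * (b2 / b1) ^+ 2.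
  by field; rewrite n1.
have sp : 0 < (b2 / b1) ^+ 2 by rewrite exprn_even_gt0//= mulf_neq0// invr_eq0.
rewrite pmulr_lge0// => k; have : b3 / b2 = 0 by apply/eqP; rewrite eq_le k32.
by move=> /eqP; rewrite mulf_eq0 invr_eq0 (negbTE n3) (negbTE n2).
Qed.
End plane.

(** * Directions towards local deterministic points *)

Section cone.
Context {R : realType} {n : nat}.
Implicit Types (d p q : corr R n) (a x : bits n) (i j : 'I_n).
Local Notation z := (@cbits n 0).

Lemma local_detE (g : 'I_n -> 'Z_2 -> 'Z_2) a x :
  local_det R g (a, x) = (a == [ffun i => g i (x i)])%:R.
Proof.
rewrite ffunE/=; have [->|/eqP ne] := eqVneq.
  by rewrite big1// => i _; rewrite ffunE eqxx.
have [i hi] : exists i, a i != g i (x i).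
  apply/existsP; rewrite -negb_forall; apply/forallP => h; apply: ne.
  by apply/ffunP => i; rewrite ffunE; apply/eqP.
by rewrite (bigD1 i)//= (negbTE hi) mul0r.
Qed.

Lemma Z2_flip (b c : 'Z_2) : b != c -> b = c + 1.
Proof. by have [->|->] := Z2P b; have [->|->] := Z2P c => // _; exact: val_inj. Qed.

(** The inputs pass from [x] to [x'] one party at a time; [y s] has the entries in [s] already
    changed. *)
Lemma flip_invariant (V : Type) (D : bits n -> V) (P : pred 'I_n) :
  (forall x j, P j -> D x = D (upd x j (x j + 1))) ->
  forall x x', (forall j, ~~ P j -> x j = x' j) -> D x = D x'.
Proof.
move=> DP x x' xx'.
pose y (s : seq 'I_n) : bits n := [ffun i => if i \in s then x' i else x i].
have hy s : D (y s) = D x.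
  elim: s => [|j s IH]; first by congr D; apply/ffunP => i; rewrite ffunE.
  rewrite -IH; have [e|ne] := eqVneq (x' j) (y s j).
    congr D; apply/ffunP => i; rewrite !ffunE inE.
    by have [->|_] //= := eqVneq i j; move: e; rewrite ffunE.
  have Pj : P j.
    apply: contraT => /xx' e; move: ne.
    by rewrite ffunE e if_same eqxx.
  rewrite [RHS](DP _ j Pj) -(Z2_flip ne); congr D; apply/ffunP => i.
  by rewrite !ffunE inE; have [->|] := eqVneq i j.
rewrite -(hy (enum 'I_n)); congr D; apply/ffunP => i.
by rewrite ffunE mem_enum.
Qed.

Definition elsewhere a j := [exists i, (i != j) && (a i != 0)].

(** The party [i0] makes the two constant strings different. *)
Lemma sum_cst0 a (D : bits n -> R) (i0 : 'I_n) : (forall x, 0 <= D x) ->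
  D (@cbits n 0) + D (@cbits n 1) <= \sum_x D x.
Proof.
move=> D0; rewrite (bigD1 (@cbits n 0))//= lerD2l (bigD1 (@cbits n 1))/=; last first.
  by apply/eqP => /ffunP/(_ i0); rewrite !ffunE.
by rewrite lerDl sumr_ge0.
Qed.

(** The flip equations make d(a|x) independent of x if a has several nonzero bits, and a function of
    x_k alone if k is the only one. These are the shapes produced by strategies that output a or 0,
    and the leftover weight goes to the all-zero strategy. *)
Lemma cone_quantum (i0 : 'I_n) d :
  (forall a x j, elsewhere a j -> d (a, x) = d (a, upd x j (x j + 1))) ->
  (forall x, \sum_a d (a, x) = 0) ->
  (forall a x, a != z -> 0 <= d (a, x)) ->
  - \sum_x d (z, x) <= 1 ->
  quantum_set R n (local_det R (fun _ _ => 0) + d).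
Proof.
move=> dflip dsum dpos deps.
pose heavy a := [forall j, elsewhere a j].
(* If a has two nonzero bits, (a, c) is the strategy with constant output a; if
   a has a single nonzero bit, this bit is output on the input c only. *)
pose g (s : bits n * 'Z_2) i (xi : 'Z_2) : 'Z_2 :=
  if heavy s.1 || (xi == s.2) then s.1 i else 0.
(* For heavy a, [(a, 0)] and [(a, 1)] are the same strategy, whence the half. *)
pose mu (s : bits n * 'Z_2) : R := if s.1 == z then 0 else
  if heavy s.1 then d (s.1, @cbits n 0) / 2 else d (s.1, @cbits n s.2).
have mu0 s : 0 <= mu s.
  rewrite /mu; case: eqP => // /eqP sz; case: ifP => _; last exact: dpos.
  by rewrite divr_ge0// dpos.
(* The mass put on a is at most the sum of d(a|x) over the two constant inputs, hence over all x;
   normalisation of d turns the total into the deficit. *)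
have Smu : \sum_s mu s <= 1.
  apply: le_trans deps.
  rewrite -(pair_bigA _ (fun a c => mu (a, c)))/=.
  apply: (@le_trans _ _ (\sum_(a | a != z) \sum_x d (a, x))).
    rewrite (bigD1 z)//= big1 ?add0r; last by move=> c _; rewrite /mu eqxx.
    apply: ler_sum => a az; apply: le_trans (sum_cst0 a i0 (fun x => dpos a x az)).
    rewrite sumZ2 /mu/= (negbTE az); case: ifP => _ //.
    by rewrite -splitr lerDl dpos.
  rewrite exchange_big/= -sumrN; apply: ler_sum => x _.
  by have := dsum x; rewrite (bigD1 z)//= => /eqP; rewrite addrC addr_eq0 => /eqP ->.
have key b x : b != z -> \sum_s mu s * local_det R (g s) (b, x) = d (b, x).
  move=> bz; rewrite -(pair_bigA _ (fun a c => mu (a, c) * local_det R (g (a, c)) (b, x)))/=.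
  rewrite (bigD1 b)//= [X in _ + X]big1 ?addr0 => [|a ab];
    rewrite sumZ2 !local_detE /mu/=.
    rewrite (negbTE bz); have [hb|/forallPn[k /existsPn hk]] := boolP (heavy b).
      have outb c : [ffun i => g (b, c) i (x i)] = b.
        by apply/ffunP => i; rewrite ffunE /g/= hb.
      rewrite !outb eqxx !mulr1 -splitr.
      apply: (@flip_invariant _ (fun x => d (b, x)) xpredT) => //.
      by move=> y j _; apply: dflip; exact: (forallP hb).
    have b0 i : i != k -> b i = 0.
      by move=> ik; have := hk i; rewrite ik/= negbK => /eqP.
    have nh : heavy b = false.
      by apply/negbTE/forallPn; exists k; apply/existsPn.
    have out c : (b == [ffun i => g (b, c) i (x i)]) = (x k == c).
      apply/eqP/eqP => [/ffunP/(_ k)|xc].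
        rewrite ffunE /g/= nh/=; case: eqP => // _ bk; exfalso.
        move/eqP: bz; apply; apply/ffunP => i; rewrite [RHS]ffunE.
        by have [->|/b0] := eqVneq i k.
      apply/ffunP => i; rewrite ffunE /g/= nh/=; have [->|/b0 ->] := eqVneq i k.
        by rewrite xc eqxx.
      by case: ifP.
    have inv : d (b, @cbits n (x k)) = d (b, x).
      apply: (@flip_invariant _ (fun x => d (b, x)) (fun j => j != k)) => [y j jk|j].
        apply: dflip; apply/existsP; exists k; rewrite eq_sym jk/=.
        apply: contra bz => /eqP bk; apply/eqP/ffunP => i; rewrite [RHS]ffunE.
        by have [->|/b0] := eqVneq i k.
      by rewrite negbK => /eqP ->; rewrite ffunE.
    rewrite !out -inv; have [->|->] := Z2P (x k);
      rewrite ?eqxx ?mulr1 /= ?mulr0 ?addr0 ?add0r //.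
  have [az|az] := eqVneq a z; first by rewrite !mul0r addr0.
  (* The strategy [(a, c)] outputs only a or 0 strings, hence never another nonzero string b. *)
  have no c : (b == [ffun i => g (a, c) i (x i)]) = false.
    apply/negbTE/eqP => /ffunP be.
    have [ha|/forallPn[k /existsPn hk]] := boolP (heavy a).
      move/eqP: ab; apply; apply/ffunP => i; by rewrite be ffunE /g/= ha.
    have nh : heavy a = false.
      by apply/negbTE/forallPn; exists k; apply/existsPn.
    have a0 i : i != k -> a i = 0.
      by move=> ik; have := hk i; rewrite ik/= negbK => /eqP.
    have [xk|xk] := eqVneq (x k) c.
      move/eqP: ab; apply; apply/ffunP => i; rewrite be ffunE /g/= nh/=.
      by have [->|/a0 ->] := eqVneq i k; [rewrite xk eqxx|case: ifP].
    move/eqP: bz; apply; apply/ffunP => i; rewrite be !ffunE /g/= nh/=.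
    by have [->|/a0 ->] := eqVneq i k; [rewrite (negbTE xk)|case: ifP].
  by rewrite !no !mulr0 addr0.
pose lam s : R := mu s + (s == (z, 0))%:R * (1 - \sum_t mu t).
have lamF (F : bits n * 'Z_2 -> R) :
    \sum_s lam s * F s = \sum_s mu s * F s + (1 - \sum_t mu t) * F (z, 0).
  under eq_bigr do rewrite mulrDl; rewrite big_split/=; congr (_ + _).
  move: (1 - _) => S.
  rewrite (bigD1 (z, 0))//= eqxx mul1r big1 ?addr0// => s /negbTE ->.
  by rewrite !mul0r.
have lam1 : \sum_s lam s = 1.
  under eq_bigr do rewrite -[lam _]mulr1.
  by rewrite (lamF (fun=> 1)); under eq_bigr do rewrite mulr1; rewrite mulr1 addrC subrK.
apply: (@classical_quantum _ _ _ i0 lam g) => // [s|].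
  by rewrite addr_ge0// mulr_ge0 ?ler0n// subr_ge0.
have off b x : b != z ->
    (local_det R (fun _ _ => 0) + d) (b, x) = \sum_s lam s * local_det R (g s) (b, x).
  move=> bz; rewrite lamF key// ffunE addrC; congr (_ + _).
  rewrite !local_detE.
  have -> : [ffun i => g (z, 0) i (x i)] = z.
    by apply/ffunP => i; rewrite !ffunE /g/=; case: ifP; rewrite ?ffunE.
  by rewrite -[X in b == X]/z (negbTE bz) mulr0.
move=> [b x]; have [->|] := eqVneq b z; last exact: off.
(* The value at the outcome 0 is recovered from normalisation: both sides sum to 1 over the outcomes
   and agree at all others. *)
have s1 : \sum_a (local_det R (fun _ _ => 0) + d) (a, x) = 1.
  under eq_bigr do rewrite ffunE; rewrite big_split/= dsum addr0.
  rewrite (bigD1 z)//= local_detE -[X in z == X]/z eqxx big1 ?addr0// => a az.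
  by rewrite local_detE -[X in a == X]/z (negbTE az).
have s2 : \sum_a \sum_s lam s * local_det R (g s) (a, x) = 1.
  rewrite exchange_big/= -lam1; apply: eq_bigr => s _; rewrite -mulr_sumr.
  rewrite (bigD1 [ffun i => g s i (x i)])//= local_detE eqxx big1 ?addr0 ?mulr1// => a az.
  by rewrite local_detE (negbTE az).
move: s1; rewrite -s2 (bigD1 z)//= [in RHS](bigD1 z)//=.
rewrite (eq_bigr (fun a => \sum_s lam s * local_det R (g s) (a, x))); last first.
  by move=> a az; exact: off.
exact: addIr.
Qed.
End cone.

(** * The theorem *)

Section relabel.
Context {R : realType} {n : nat} (f : 'I_n -> 'Z_2 -> 'Z_2).
Implicit Types (d p q : corr R n) (a x : bits n).

(** Adding [f i (x i)] in Z_2 is an involution that exchanges the given deterministic point with the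
    all-zero one. *)
Definition relabel p : corr R n :=
  [ffun s : bits n * bits n => p ([ffun i => s.1 i + f i (s.2 i)], s.2)].

Lemma relabelE p a x : relabel p (a, x) = p ([ffun i => a i + f i (x i)], x).
Proof. by rewrite ffunE. Qed.

Lemma relabel_linear (c : R) p q : relabel (c *: p + q) = c *: relabel p + relabel q.
Proof. by apply/ffunP => s; rewrite !ffunE. Qed.

Lemma relabelB p q : relabel (p - q) = relabel p - relabel q.
Proof. by apply/ffunP => s; rewrite !ffunE. Qed.

Lemma relabelD p q : relabel (p + q) = relabel p + relabel q.
Proof. by apply/ffunP => s; rewrite !ffunE. Qed.

Lemma Z2_addK (b c : 'Z_2) : b + c + c = b.
Proof.
by have [->|->] := Z2P c; rewrite ?addr0// -addrA (_ : 1 + 1 = 0) ?addr0//; exact: val_inj.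
Qed.

Lemma relabelK : involutive relabel.
Proof.
move=> p; apply/ffunP => -[a x]; rewrite !relabelE; congr (p (_, x)).
by apply/ffunP => i; rewrite !ffunE Z2_addK.
Qed.

Lemma relabel_local_det : relabel (local_det R f) = local_det R (fun _ _ => 0).
Proof.
apply/ffunP => -[a x]; rewrite relabelE !ffunE; apply: eq_bigr => i _.
by rewrite ffunE -subr_eq0 addrK.
Qed.

Lemma relabel_quantum p : quantum_set R n p -> quantum_set R n (relabel p).
Proof.
move=> [[H K rho hr M hM] hp]; rewrite /realizes /= in hp.
have hM' (i : 'I_n) (xi : 'Z_2) : povm (fun b => M i xi (b + f i xi)).
  have [h1 h2 h3] := hM i xi; split=> [b|b|v]; [exact: h1|exact: h2|].
  rewrite -[RHS]h3; symmetry.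
  by rewrite (reindex_inj (addIr (f i xi))).
exists (QuantumStrategy (qtensor := K) hr hM') => a x /=.
have [T [[bT TE] tT]] := hp [ffun i => a i + f i (x i)] x.
exists T; split; last by rewrite relabelE.
split=> // y; rewrite TE; congr (tens K _).
by apply: functional_extensionality_dep => i; rewrite ffunE.
Qed.

Lemma relabel_ext p : Ext (quantum_set R n) p -> Ext (quantum_set R n) (relabel p).
Proof.
move=> [Qp ep]; split; first exact: relabel_quantum.
move=> q r t Qq Qr t01 E.
have [|e1 e2] := ep _ _ t (relabel_quantum Qq) (relabel_quantum Qr) t01.
  rewrite -[p]relabelK E relabel_linear; congr (_ + _).
  by apply/ffunP => s; rewrite !ffunE.
by split; [rewrite -e1 relabelK|rewrite -e2 relabelK].
Qed.
End relabel.

Section main.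
Context {R : realType} {n : nat} (f : 'I_n -> 'Z_2 -> 'Z_2).
Implicit Types (d p q : corr R n) (a x : bits n).
Local Notation z := (@cbits n 0).
Local Notation p0 := (local_det R f).

(** The linear form whose value at q - p0 is the defect of the relabelled q. *)
Definition deficit d : R := - \sum_x relabel f d (z, x).

(* The linear equations of the span of the local deterministic directions
   d - p0 that meet p0 to first order, together with normalization. *)
Definition flip_form (m : bits n * bits n * 'I_n + bits n) d : R :=
  match m with
  | inl (a, x, j) => if elsewhere a j
      then relabel f d (a, x) - relabel f d (a, upd x j (x j + 1)) else 0
  | inr x => \sum_a relabel f d (a, x)
  end.

(** The outcome 0 is left out because q - p0 is nonpositive there for quantum q. *)
Definition outcome_form (k : bits n * bits n) d : R :=
  if k.1 == z then 0 else relabel f d k.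

Lemma deficit_linear : linear_form deficit.
Proof.
move=> a u v; rewrite /deficit relabel_linear mulrN -opprD mulr_sumr -big_split/=.
by congr (- _); apply: eq_bigr => x _; rewrite !ffunE.
Qed.

Lemma flip_form_linear m : linear_form (flip_form m).
Proof.
case: m => [[[a x] j]|x] c u v /=; rewrite relabel_linear.
  by case: ifP => _; rewrite ?mulr0 ?addr0// !ffunE /GRing.scale/=; ring.
by rewrite mulr_sumr -big_split/=; apply: eq_bigr => a _; rewrite !ffunE.
Qed.

Lemma outcome_form_linear k : linear_form (outcome_form k).
Proof.
move=> c u v; rewrite /outcome_form relabel_linear; case: ifP => _.
  by rewrite mulr0 addr0.
by rewrite !ffunE.
Qed.

Lemma relabel_sub_det q a x :
  relabel f (q - p0) (a, x) = relabel f q (a, x) - (a == z)%:R.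
Proof.
by rewrite relabelB relabel_local_det [LHS]ffunE [(- local_det _ _) _]ffunE local_detE.
Qed.

Lemma deficitE q : deficit (q - p0) = defect (relabel f q).
Proof.
rewrite /deficit /defect -sumrN; apply: eq_bigr => x _.
by rewrite relabel_sub_det eqxx opprB.
Qed.

Lemma deficit_ge0 q : quantum_set R n q -> 0 <= deficit (q - p0).
Proof.
move=> /(relabel_quantum f) Qq; rewrite deficitE.
by have := sum_le_defect z (P := pred0) Qq isT; rewrite big_pred0.
Qed.

Lemma deficit_eq0 q : quantum_set R n q -> deficit (q - p0) = 0 -> q = p0.
Proof.
move=> /(relabel_quantum f) Qq; rewrite deficitE => d0.
rewrite -[q](relabelK f) -[p0](relabelK f); congr relabel.
rewrite relabel_local_det; apply/ffunP => -[a x]; rewrite local_detE -[X in _ == X]/z.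
have off b : b != z -> relabel f q (b, x) = 0.
  move=> bz; have := sum_le_defect x (P := pred1 b) Qq _.
  rewrite /= eq_sym bz big_pred1_eq d0 => /(_ isT) le0.
  by apply/eqP; rewrite eq_le le0 quantum_ge0.
have [->|az] := eqVneq a z; last exact: off.
have := quantum_sum1 x Qq; rewrite (bigD1 z)//= big1 ?addr0// => b; exact: off.
Qed.

Lemma outcome_ge0 q k : quantum_set R n q -> 0 <= outcome_form k (q - p0).
Proof.
move=> /(relabel_quantum f) Qq; case: k => a x; rewrite /outcome_form/=.
case: eqP => // /eqP az; rewrite relabel_sub_det (negbTE az) subr0.
exact: quantum_ge0.
Qed.

(** In a flip, p0 cancels because its relabelled entry at a does not depend on x. The normalisation
    forms vanish on q - p0. *)
Lemma flip_le q m : Ext (quantum_set R n) q ->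
  flip_form m (q - p0) ^+ 2 <= 4 * deficit (q - p0) ^+ 3.
Proof.
move=> eq; have d0 := deficit_ge0 eq.1.
have nonneg : 0 <= 4 * deficit (q - p0) ^+ 3 by rewrite mulr_ge0// exprn_ge0.
case: m => [[[a x] j]|x] /=.
  case: ifP => [/existsP[i /andP[ij ai]]|_]; last by rewrite expr0n.
  have -> : relabel f (q - p0) (a, x) - relabel f (q - p0) (a, upd x j (x j + 1)) =
      relabel f q (a, x) - relabel f q (a, upd x j (x j + 1)).
    by rewrite !relabel_sub_det opprB addrA subrK.
  rewrite deficitE.
  by apply: ext_flip; [exact: relabel_ext|exists i].
under eq_bigr do rewrite relabel_sub_det.
rewrite sumrB (quantum_sum1 x (relabel_quantum f eq.1)) (bigD1 z)//= eqxx.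
rewrite big1 ?addr0 ?subrr ?expr0n// => a /negbTE ->.
by [].
Qed.

Lemma cone_quantum_det (i0 : 'I_n) d : (forall m, flip_form m d = 0) ->
  (forall k, 0 <= outcome_form k d) -> deficit d <= 1 -> quantum_set R n (p0 + d).
Proof.
move=> hl ho hd; rewrite -[p0 + d](relabelK f) relabelD relabel_local_det.
apply/relabel_quantum/(cone_quantum i0) => [a x j aj|x|a x az|//].
- by have /= := hl (inl (a, x, j)); rewrite aj => /eqP; rewrite subr_eq0 => /eqP.
- exact: hl (inr x).
- by have := ho (a, x); rewrite /outcome_form/= (negbTE az).
Qed.

(** [deficit] exposes p0: on quantum correlations it is nonnegative and vanishes at p0 alone. *)
Lemma det_ext : quantum_set R n p0 -> Ext (quantum_set R n) p0.
Proof.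
move=> Q0; split=> // q r t Qq Qr /andP[t0 t1] E.
have e : deficit (t *: (q - p0) + (1 - t) *: (r - p0)) = 0.
  rewrite -(linear_form0 deficit_linear); congr deficit.
  by rewrite !scalerBr addrACA -opprD -scalerDl -E (addrC t) subrK scale1r subrr.
have := deficit_ge0 Qq; have := deficit_ge0 Qr.
move: e; rewrite (linear_form2 _ _ _ _ deficit_linear).
set A := deficit _; set B := deficit _ => e B0 A0.
have A00 : A = 0 by nra.
have B00 : B = 0 by nra.
by split; apply: deficit_eq0.
Qed.

(** The deficit adds one coordinate per input string, each bounded by the Euclidean distance, whence
    the divisor. *)
Lemma deficit_ball q (r : R) : 0 < r ->
  euclidean_ball p0 (r / #|{: bits n}|%:R) q -> deficit (q - p0) < r.
Proof.
move=> r0; rewrite /euclidean_ball /= => hq.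
have c0 : 0 < #|{: bits n}|%:R :> R by rewrite ltr0n; apply/card_gt0P; exists z.
move: hq; rewrite ltr_pdivlMr//; apply: le_lt_trans.
rewrite /deficit -sumrN mulr_natr -sumr_const; apply: ler_sum => x _.
rewrite relabelE; apply: le_trans (ler_norm _) _; rewrite normrN -sqrtr_sqr.
rewrite ler_sqrt; last by rewrite sumr_ge0// => s _; exact: sqr_ge0.
rewrite (bigD1 ([ffun i => z i + f i (x i)], x))//= !ffunE lerDl sumr_ge0// => s _.
exact: sqr_ge0.
Qed.
End main.

Lemma plane_span (R : realType) (E : vectType R) (V : {vspace E}) : \dim V = 2%N ->
  exists u v, forall w, w \in V -> exists s t, w = s *: u + t *: v.
Proof.
move=> dV; have [X bX] : exists X : 2.-tuple E, basis_of V X.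
  by rewrite -dV; exists (vbasis V); exact: vbasisP.
exists X`_0, X`_1 => w wV; exists (coord X ord0 w), (coord X (lift ord0 ord0) w).
by rewrite {1}(coord_basis bX wV) big_ord_recl big_ord1.
Qed.

Theorem theorem1 (R : realType) (n : nat) (hn : (1 <= n)%N)
  (f : 'I_n -> 'Z_2 -> 'Z_2) (P : set (corr R n)) (hP : affine_plane P)
  (hf : (quantum_set R n `&` P) (local_det R f)) :
  exists r : R, 0 < r /\
    Ext (quantum_set R n) `&` P `&` euclidean_ball (local_det R f) r
      = [set local_det R f].
Proof.
have [Q0 P0] := hf; have [o [V [dV PE]]] := hP.
have [u [v uv]] := plane_span dV.
pose i0 : 'I_n := Ordinal hn.
have [r r0 hr] := plane_extreme_isolated u v (deficit_linear f) (flip_form_linear f)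
  (outcome_form_linear f) Q0 (@deficit_ge0 _ _ f) (@deficit_eq0 _ _ f)
  (@outcome_ge0 _ _ f) (@flip_le _ _ f) (@cone_quantum_det _ _ f i0).
have c0 : 0 < #|{: bits n}|%:R :> R.
  by rewrite ltr0n; apply/card_gt0P; exists (@cbits n 0).
exists (r / #|{: bits n}|%:R); split; first by rewrite divr_gt0.
apply/seteqP; split=> [q [[eq Pq] Bq]|q ->] /=.
  apply: hr => //; last exact: deficit_ball.
  apply: uv; move: P0 Pq; rewrite PE /= => h0 hq.
  by rewrite -(subrK o q) -addrA -[o - _]opprB rpredB.
split; first by split=> //; exact: det_ext.
rewrite /euclidean_ball /= big1 ?sqrtr0 ?divr_gt0// => s _.
by rewrite subrr expr0n.
Qed.
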